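(* Fix the spacetime dimension $D$ and consider the set of all irreducible curvature invariants of a given order which do not involve covariant derivatives of the curvature. If one of these invariants is completable to a generalized quasi-topological density and does not vanish when evaluated on a general static and spherically symmetric ansatz, then all the invariants in the set are completable to generalized quasi-topological densities.
   Context: Order: an invariant built from contractions of $n$ Riemann tensors with metrics has order $2n$ in derivatives of the metric (order $n$ in curvature). Static spherically symmetric (SSS) ansatz: $ds^2_{N,f}=-N(r)^2f(r)\,dt^2+\dfrac{dr^2}{f(r)}+r^2d\Omega^2_{D-2}$, with $N,f$ arbitrary functions and $d\Omega_{D-2}^2$ the metric of the unit sphere $\mathbb{S}^{D-2}$. Generalized quasi-topological (GQT) density: a density $\mathcal{L}$ such that, with $L_f=r^{D-2}\mathcal{L}|_{N=1,f}$ the Lagrangian $\sqrt{-g}\mathcal{L}$ evaluated on the SSS ansatz with $N=1$ (dropping the angular factor), the Euler–Lagrange expression vanishes identically for every $f$: $\frac{\partial L_f}{\partial f}-\frac{d}{dr}\frac{\partial L_f}{\partial f'}+\frac{d^2}{dr^2}\frac{\partial L_f}{\partial f''}-\dots=0$. Reducible/irreducible: a curvature invariant is reducible if it is a total derivative (possibly zero) when evaluated on any Ricci-flat metric; otherwise it is irreducible. Completable: a curvature invariant $\mathcal{L}$ is completable to a GQT density (completable, for short) if there exists a GQT density $\mathcal{Q}$ such that $\mathcal{L}-\mathcal{Q}$ is reducible. Known fact that may be used (Deser–Ryzhov): on the SSS ansatz all full contractions of $n$ Weyl tensors are of the form $c_i F(r)^n$, with $c_i$ a constant depending on the contraction and $F(r)$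 a function independent of the contraction. *)

(* Defs.v *)
From HB Require Import structures.
From mathcomp Require Import all_boot all_order all_algebra.
From mathcomp Require Import all_classical all_reals all_analysis.

Set Implicit Arguments.
Unset Strict Implicit.
Unset Printing Implicit Defensive.

Import Order.TTheory GRing.Theory Num.Theory.
Import numFieldNormedType.Exports.

Local Open Scope classical_set_scope.
Local Open Scope ring_scope.

(* Everything is local, so spacetimes are open subsets of R^D carrying a
   metric given by its matrix of components.  The dimension is D = d.+2, so
   that d is the dimension of the spheres of a spherically symmetric
   spacetime; coordinate 0 is t, coordinate 1 is r. *)

Section Smoothness.
Context {R : realType} {V : normedModType R}.

Fixpoint ck_on (k : nat) (U : set V) (f : V -> R) : Prop :=
  (forall x, U x -> {for x, continuous f}) /\
  if k is k'.+1 then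
    forall v, (forall x, U x -> derivable f x v) /\ ck_on k' U ('D_v f)
  else True.

Definition smooth_on (U : set V) (f : V -> R) : Prop :=
  forall k, ck_on k U f.

End Smoothness.

Section Geometry.
Context {R : realType} {d : nat}.

Local Notation D := d.+2.
Local Notation point := 'rV[R]_D.

Definition metric_field : Type := point -> 'M[R]_D.

Definition partial (i : 'I_D) (f : point -> R) : point -> R :=
  'D_(delta_mx 0 i) f.

(* Signature (-,+,...,+), in the sense of Sylvester's law of inertia. *)
Definition lorentzian (M : 'M[R]_D) : Prop :=
  exists2 P : 'M[R]_D, P \in unitmx &
    P *m M *m P^T = diag_mx (\row_i (if i == 0 then - 1 else 1)).

Definition lorentzian_metric_on (U : set point) (g : metric_field) : Prop :=
  (forall i j, smooth_on U (fun x => g x i j)) /\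
  (forall x, U x -> lorentzian (g x)).

Section Curvature.
Variable g : metric_field.

Definition inverse_metric (a b : 'I_D) (x : point) : R := invmx (g x) a b.

(* christoffel a b c = Gamma^a_{bc} *)
Definition christoffel (a b c : 'I_D) (x : point) : R :=
  2^-1 * \sum_e inverse_metric a e x *
    (partial b (fun y => g y e c) x + partial c (fun y => g y e b) x
     - partial e (fun y => g y b c) x).

(* riemann_up a b c e = R^a_{bce} *)
Definition riemann_up (a b c e : 'I_D) (x : point) : R :=
  partial c (christoffel a e b) x - partial e (christoffel a c b) x
  + \sum_h (christoffel a c h x * christoffel h e b x
            - christoffel a e h x * christoffel h c b x).

Definition riemann (a b c e : 'I_D) (x : point) : R :=
  \sum_h g x a h * riemann_up h b c e x.

Definition ricci (b c : 'I_D) (x : point) : R :=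
  \sum_a riemann_up a b a c x.

End Curvature.

Definition ricci_flat_on (U : set point) (g : metric_field) : Prop :=
  forall x b c, U x -> ricci g b c x = 0.

(* A tensor built from the metric: its fully covariant components
   T g [:: i_1; ...; i_r] x; only index lists of length the rank r matter. *)
Definition tensor : Type := metric_field -> seq 'I_D -> point -> R.

Definition metric_tensor : tensor := fun g s x =>
  if s is [:: a; b] then g x a b else 0.

Definition riemann_tensor : tensor := fun g s x =>
  if s is [:: a; b; c; e] then riemann g a b c e x else 0.

(* The new index comes first. *)
Definition covariant_derivative (T : tensor) : tensor := fun g s x =>
  if s is c :: s' then
    partial c (T g s') x
    - \sum_(j < size s') \sum_e
        christoffel g e c (nth 0 s' j) x * T g (set_nth 0 s' j e) x
  else 0.

Definition tensor_product (r : nat) (T S : tensor) : tensor := fun g s x =>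
  T g (take r s) x * S g (drop r s) x.

(* Contraction of the first two indices. *)
Definition contract_indices (T : tensor) : tensor := fun g s x =>
  \sum_a \sum_b inverse_metric g a b x * T g [:: a, b & s] x.

Definition permute_indices (p : seq nat) (T : tensor) : tensor := fun g s x =>
  T g [seq nth 0 s j | j <- p] x.

(* curvature_tensor nabla k r T: T is a rank r tensor built from the metric and
   the Riemann tensor, homogeneous of order k in derivatives of the metric;
   covariant derivatives of the curvature may occur only if nabla = true.
   For nabla = false the tensors of order 2n and rank 0 are exactly the linear
   combinations of full contractions of n Riemann tensors with metrics. *)
Inductive curvature_tensor (nabla : bool) : nat -> nat -> tensor -> Prop :=
| ct_metric : curvature_tensor nabla 0 2 metric_tensor
| ct_riemann : curvature_tensor nabla 2 4 riemann_tensor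
| ct_nabla k r T : nabla -> curvature_tensor nabla k r T ->
    curvature_tensor nabla k.+1 r.+1 (covariant_derivative T)
| ct_product k l r s T S :
    curvature_tensor nabla k r T -> curvature_tensor nabla l s S ->
    curvature_tensor nabla (k + l) (r + s) (tensor_product r T S)
| ct_contraction k r T : curvature_tensor nabla k r.+2 T ->
    curvature_tensor nabla k r (contract_indices T)
| ct_permute k r p T : perm_eq p (iota 0 r) -> curvature_tensor nabla k r T ->
    curvature_tensor nabla k r (permute_indices p T)
| ct_add k r T S :
    curvature_tensor nabla k r T -> curvature_tensor nabla k r S ->
    curvature_tensor nabla k r (fun g s x => T g s x + S g s x)
| ct_scale k r (a : R) T : curvature_tensor nabla k r T ->
    curvature_tensor nabla k r (fun g s x => a * T g s x).

Definition invariant_density : Type := metric_field -> point -> R.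

Definition homogeneous_invariant (nabla : bool) (k : nat) (L : invariant_density) : Prop :=
  exists2 T, curvature_tensor nabla k 0 T &
    forall g x, L g x = T g [::] x.

(* Finite sums of homogeneous invariants of any orders, covariant derivatives
   of the curvature allowed. *)
Definition curvature_invariant (L : invariant_density) : Prop :=
  exists K (F : 'I_K -> invariant_density),
    (forall i, exists k, homogeneous_invariant true k (F i)) /\
    (forall g x, L g x = \sum_i F i g x).

(* The jet of order k of g at x, as a row vector: all the iterated partial
   derivatives, of order at most k, of the components of g. *)
Definition jet_index (k : nat) : finType :=
  ({bseq k of 'I_D} * 'I_D * 'I_D)%type.

Definition metric_jet (k : nat) (g : metric_field) (x : point) :
    'rV[R]_#|jet_index k| :=
  \row_i (let: (w, a, b) := enum_val i : jet_index k in
          foldr partial (fun y => g y a b) w x).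

(* sqrt|g| L is the divergence of a current on every Ricci-flat metric.  The
   current must be local: one and the same smooth function of finitely many
   derivatives of the metric, for all metrics.  (With a current allowed to
   depend arbitrarily on the metric every scalar would locally be a
   divergence.)  It need not be covariant, so that topological densities such as
   the four-dimensional Gauss-Bonnet one count as total derivatives. *)
Definition reducible (L : invariant_density) : Prop :=
  exists k (O : set 'rV[R]_#|jet_index k|)
         (J : 'I_D -> 'rV[R]_#|jet_index k| -> R),
    [/\ open O,
        (forall a, smooth_on O (J a)),
        (forall U g, open U -> lorentzian_metric_on U g ->
           forall x, U x -> O (metric_jet k g x)) &
        (forall U g, open U -> lorentzian_metric_on U g -> ricci_flat_on U g ->
           forall x, U x ->
           Num.sqrt `|\det (g x)| * L g x =
             \sum_a partial a (fun y => J a (metric_jet k g y)) x)].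

Definition irreducible (L : invariant_density) : Prop := ~ reducible L.

(* - N^2 f dt^2 + dr^2 / f + r^2 dOmega^2, where the unit d-sphere minus a point
   is parametrised by stereographic coordinates y in R^d, in which
   dOmega^2 = 4 |dy|^2 / (1 + |y|^2)^2. *)
Definition sss_metric (N f : R -> R) : metric_field := fun x =>
  let r := x 0 1 in
  let rho2 := \sum_(i < D | (1 < i)%N) x 0 i ^+ 2 in
  diag_mx (\row_(i < D)
    match val i with
    | 0%N => - (N r ^+ 2 * f r)
    | 1%N => (f r)^-1
    | _ => r ^+ 2 * (4 / (1 + rho2) ^+ 2)
    end).

Definition admissible_profile (I : set R) (f : R -> R) : Prop :=
  smooth_on I f /\ (forall r, I r -> f r != 0).

Definition radial_domain (I : set R) : Prop :=
  open I /\ (forall r, I r -> 0 < r).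

Definition nonvanishing_on_sss (L : invariant_density) : Prop :=
  exists I N f, [/\ radial_domain I, admissible_profile I N,
    admissible_profile I f &
    exists2 x : point, I (x 0 1) & L (sss_metric N f) x != 0].

Definition profile_jet (k : nat) (f : R -> R) (r : R) : 'rV[R]_k.+1 :=
  \row_(i < k.+1) derive1n i f r.

(* l represents L_f = r^(D-2) L|_{N=1,f} as a function of r, f, f', ...,
   f^(k).  Every jet with f != 0 at every r > 0 is attained, so l is
   determined where it matters. *)
Definition reduced_lagrangian (L : invariant_density) (k : nat)
    (l : R -> 'rV[R]_k.+1 -> R) : Prop :=
  forall I f, radial_domain I -> admissible_profile I f ->
    forall x : point, I (x 0 1) ->
      x 0 1 ^+ d * L (sss_metric (fun=> 1) f) x =
        l (x 0 1) (profile_jet k f (x 0 1)).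

Definition euler_lagrange (k : nat) (l : R -> 'rV[R]_k.+1 -> R)
    (f : R -> R) (r : R) : R :=
  \sum_(i < k.+1) (- 1) ^+ i *
    derive1n i (fun s => 'D_(delta_mx 0 i) (l s) (profile_jet k f s)) r.

Definition gqt_density (L : invariant_density) : Prop :=
  curvature_invariant L /\
  exists k (l : R -> 'rV[R]_k.+1 -> R),
    reduced_lagrangian L l /\
    (forall I f, radial_domain I -> admissible_profile I f ->
       forall r, I r -> euler_lagrange l f r = 0).

Definition completable (L : invariant_density) : Prop :=
  exists2 Q : invariant_density, gqt_density Q & reducible (fun g x => L g x - Q g x).

End Geometry.

Arguments invariant_density R d : clear implicits.

(* Main.v *)
Require Import Defs.
From mathcomp Require Import all_boot all_order all_algebra.
From mathcomp Require Import all_classical all_reals all_analysis.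
From mathcomp Require Import fingroup perm ring lra.

(* Idea. Replacing the Riemann tensor by the Weyl tensor changes an invariant L
   of order 2n only by terms that vanish on Ricci-flat metrics, and on the
   N = 1 static spherically symmetric metrics the result L' equals c F^n
   (Deser-Ryzhov), with F the only independent component of the Weyl tensor.
   The Weyl part of L0 may vanish on these metrics although L0 does not, so a
   completion of L is built directly instead of from the one of L0.  With A, B,
   psi the sectional curvatures of the metric, r^d times the density
     (d+1) G + (A - B) dG/dB + 2 (B - psi) dG/dpsi
   is the derivative of r^(d+1) G(B, psi), hence has vanishing Euler-Lagrange
   expression.  For a suitable form G of degree n >= 2 it is c' F^n, with c'
   nonzero, plus monomials containing the Ricci scalar or the traceless Ricci
   tensor that are all values of contractions of Riemann tensors; let C be the
   sum of these contractions.  Then Q = L' + (c / c') C is a GQT density and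
   L - Q vanishes on Ricci-flat metrics. *)

Set Implicit Arguments.
Unset Strict Implicit.
Unset Printing Implicit Defensive.

Import Order.TTheory GRing.Theory Num.Theory.
Import numFieldNormedType.Exports.

Local Open Scope classical_set_scope.
Local Open Scope ring_scope.

(** * Directional derivatives *)

(** The Weyl array of a static spherically symmetric metric is a fixed array times one function
    [phi], so homogeneity of a contraction in the curvature produces the form c F^n. What restricts
    G is that not every monomial in [rho], [zeta], [phi] is the value of a contraction: those with
    exactly [zeta], [phi] or [zeta * phi] besides powers of [rho] are missing, and in dimension four
    all odd powers of [zeta] are. A form G equal to B^(n-2) times a quadratic form in B and psi
    suffices. The coefficient of [phi] vanishes for every such form; the other two conditions fix
    the quadratic form up to scale. It remains to see that the coefficient of [phi ^+ n] is not zero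
    for these weights. The construction starts at n = 2. For n = 0 the Weyl part is constant, and
    for n = 1 it vanishes, being a multiple of the trace of a trace-free array. In dimensions two
    and three the Riemann tensor is determined by the Ricci tensor, and the Weyl part is constant as
    well. *)

Section Derivatives.
Context {R : realType} {V : normedModType R}.

Lemma is_derive_add (x v : V) (f g : V -> R) a b :
  is_derive x v f a -> is_derive x v g b ->
  is_derive x v (fun y => f y + g y) (a + b).
Proof. by move=> ? ?; exact: is_deriveD. Qed.

Lemma is_derive_opp (x v : V) (f : V -> R) a :
  is_derive x v f a -> is_derive x v (fun y => - f y) (- a).
Proof. by move=> ?; exact: is_deriveN. Qed.

Lemma is_derive_mul (x v : V) (f g : V -> R) a b :
  is_derive x v f a -> is_derive x v g b ->
  is_derive x v (fun y => f y * g y) (a * g x + f x * b).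
Proof.
move=> fa gb; have := @is_deriveM _ _ _ _ _ _ _ _ fa gb.
move=> h; apply: is_derive_eq h _.
by rewrite /GRing.scale /= addrC mulrC.
Qed.

Lemma is_derive_inv (x v : V) (f : V -> R) a :
  f x != 0 -> is_derive x v f a ->
  is_derive x v (fun y => (f y)^-1) (- a / f x ^+ 2).
Proof.
move=> fx0 [fd <-]; split; first exact: derivableV.
rewrite deriveV // /GRing.scale /= mulNr mulrC mulNr; congr (- (_ * _)).
Qed.

Lemma is_derive_pow (x v : V) (f : V -> R) a n :
  is_derive x v f a ->
  is_derive x v (fun y => f y ^+ n) (n%:R * f x ^+ n.-1 * a).
Proof.
move=> fa; have h := @is_deriveX _ _ f n x v a fa.
have -> : (fun y => f y ^+ n) = f ^+ n by rewrite exprfctE.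
by apply: is_derive_eq h _; rewrite /GRing.scale /= mulr_natl.
Qed.

Lemma is_derive_bigsum (I : Type) (r : seq I) (P : pred I) (x v : V)
    (f : I -> V -> R) (a : I -> R) :
  (forall i, P i -> is_derive x v (f i) (a i)) ->
  is_derive x v (fun y => \sum_(i <- r | P i) f i y) (\sum_(i <- r | P i) a i).
Proof.
move=> fa; elim: r => [|i r IH].
  rewrite big_nil; have -> : (fun y => \sum_(i <- [::] | P i) f i y) = cst 0.
    by apply/funext => y; rewrite big_nil.
  exact: is_derive_cst.
have -> : (fun y => \sum_(j <- i :: r | P j) f j y) =
  (fun y => if P i then f i y + \sum_(j <- r | P j) f j y
            else \sum_(j <- r | P j) f j y).
  by apply/funext => y; rewrite big_cons.
rewrite big_cons; case: ifPn => // Pi; exact: is_derive_add (fa _ Pi) IH.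
Qed.

(** The two difference quotients coincide, so directional derivatives of functions of a single
    coordinate reduce to one real variable. *)
Lemma is_derive_line (x v : V) (f : V -> R) a :
  is_derive (0 : R) 1 (fun t => f (t *: v + x)) a -> is_derive x v f a.
Proof.
have E : (fun h : R => h^-1 *: (f ((h *: (1 : R) + 0 : R) *: v + x) - f (0 *: v + x)))
   = (fun h : R => h^-1 *: (f (h *: v + x) - f x)).
  by apply/funext => h; rewrite addr0 scale0r add0r /GRing.scale /= mulr1.
by case; rewrite /derivable /derive E => h1 h2; split.
Qed.

Lemma is_derive_val (x v : V) (f : V -> R) a :
  is_derive x v f a -> 'D_v f x = a.
Proof. by case. Qed.

Lemma is_derive_near (x v : V) (U : set V) (f g : V -> R) a :
  open U -> U x -> (forall y, U y -> f y = g y) ->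
  is_derive x v f a -> is_derive x v g a.
Proof.
move=> oU Ux fg; apply: near_eq_is_derive => //.
by near=> y; apply: fg; near: y; exact: open_nbhs_nbhs.
Unshelve. all: by end_near. Qed.

End Derivatives.

Section Coordinates.
Context {R : realType} {n : nat}.

Lemma is_derive_coord (x v : 'rV[R]_n.+1) (i : 'I_n.+1) :
  is_derive x v (fun y : 'rV[R]_n.+1 => y 0 i) (v 0 i).
Proof.
apply: is_derive_line.
have -> : (fun t : R => (t *: v + x) 0 i) = (fun t => t * v 0 i + x 0 i).
  by apply/funext => t; rewrite !mxE.
have h := is_derive_add (is_derive_mul (is_derive_id (0 : R) 1)
   (is_derive_cst (v 0 i) (0 : R) 1)) (is_derive_cst (x 0 i) (0 : R) 1).
apply: is_derive_eq h _.
by rewrite /cst mul1r mulr0 !addr0.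
Qed.

Lemma is_derive_coord_comp (x v : 'rV[R]_n.+1) (i : 'I_n.+1) (f : R -> R) a :
  is_derive (x 0 i) 1 f a ->
  is_derive x v (fun y : 'rV[R]_n.+1 => f (y 0 i)) (v 0 i * a).
Proof.
move=> fa; apply: is_derive_line.
have -> : (fun t : R => f ((t *: v + x) 0 i)) =
    f \o (fun t => t * v 0 i + x 0 i).
  by apply/funext => t; rewrite /= !mxE.
have h := is_derive_add (is_derive_mul (is_derive_id (0 : R) 1)
   (is_derive_cst (v 0 i) (0 : R) 1)) (is_derive_cst (x 0 i) (0 : R) 1).
have e : (fun t : R => t * v 0 i + x 0 i) 0 = x 0 i by rewrite mul0r add0r.
rewrite -e in fa.
have h2 := @is_derive1_comp _ f (fun t => t * v 0 i + x 0 i) 0 _ _ fa h.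
apply: is_derive_eq h2 _.
by rewrite /cst mul1r mulr0 !addr0 mulrC.
Qed.

End Coordinates.

Ltac simpl_neq :=
  repeat match goal with
  | H : is_true (?x != ?y) |- context [?x == ?y] => rewrite (negbTE H)
  | H : is_true (?x != ?y) |- context [?y == ?x] => rewrite (eq_sym y x) (negbTE H)
  end; rewrite ?eqxx /=.

(** * Curvature of diagonal metrics *)

Section DiagonalMetric.
Context {R : realType} {d : nat}.
Local Notation D := d.+2.
Local Notation point := 'rV[R]_D.

Variables (g : @metric_field R d) (U : set point) (h : 'I_D -> point -> R).
(** [lam a b] is half the logarithmic derivative of [h a] along coordinate [b], and [mu a b c] the
    derivative of [lam a b] along [c]. In these variables the curvature is polynomial up to
    quotients of the [h i], whatever their signs. *)
Variables (lam : 'I_D -> 'I_D -> point -> R).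
Variables (mu : 'I_D -> 'I_D -> 'I_D -> point -> R).

Hypothesis oU : open U.
Hypothesis gE : forall x, g x = diag_mx (\row_i h i x).
Hypothesis h_neq0 : forall x i, U x -> h i x != 0.
Hypothesis dh : forall x i b, U x ->
  is_derive x (delta_mx 0 b : point) (h i) (2 * h i x * lam i b x).
Hypothesis dlam : forall x a b c, U x ->
  is_derive x (delta_mx 0 c : point) (lam a b) (mu a b c x).

Lemma sum_delta (n : nat) (a : 'I_n) (F : 'I_n -> R) :
  \sum_i (a == i)%:R * F i = F a.
Proof.
rewrite (bigD1 a) //= eqxx mul1r big1 ?addr0 // => i ia.
by rewrite eq_sym (negbTE ia) mul0r.
Qed.

Lemma invmx_diag (n : nat) (k : 'I_n -> R) : (forall i, k i != 0) ->
  invmx (diag_mx (\row_i k i)) = diag_mx (\row_i (k i)^-1).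
Proof.
move=> k0.
have E : diag_mx (\row_i (k i)^-1) *m diag_mx (\row_i k i) = 1%:M :> 'M[R]_n.
  apply/matrixP => i j; rewrite mul_diag_mx !mxE.
  by have [->|ij] := eqVneq i j; rewrite ?mulr1n ?mulVf // mulr0n mulr0.
have u : diag_mx (\row_i k i) \in unitmx by case/mulmx1_unit: E.
by rewrite -[RHS]mulmx1 -(mulmxV u) mulmxA E mul1mx.
Qed.

Lemma inverse_metric_diag x a b : U x ->
  inverse_metric g a b x = (a == b)%:R * (h a x)^-1.
Proof.
move=> Ux; rewrite /inverse_metric gE invmx_diag; last by move=> i; exact: h_neq0.
by rewrite !mxE mulr_natl; case: eqP.
Qed.

Lemma metric_entry a b : (fun x => g x a b) = (fun x => (a == b)%:R * h a x).
Proof. by apply/funext => x; rewrite gE !mxE mulr_natl; case: eqP. Qed.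

Lemma partial_metric x a b c : U x ->
  partial c (fun y => g y a b) x = (a == b)%:R * (2 * h a x * lam a c x).
Proof.
move=> Ux; rewrite /partial metric_entry; apply: is_derive_val.
have := is_derive_mul (is_derive_cst ((a == b)%:R : R) x (delta_mx 0 c : point)) (dh a c Ux).
by move=> H; apply: is_derive_eq H _; rewrite mul0r add0r.
Qed.

Definition diag_christoffel (a b c : 'I_D) (x : point) : R :=
  (a == c)%:R * lam a b x + (a == b)%:R * lam a c x
  - (b == c)%:R * (h b x * lam b a x * (h a x)^-1).

Lemma christoffel_diag x a b c : U x ->
  christoffel g a b c x = diag_christoffel a b c x.
Proof.
move=> Ux; rewrite /christoffel.
under eq_bigr do rewrite inverse_metric_diag // !partial_metric // -[_ * _^-1 * _]mulrA.
rewrite sum_delta /diag_christoffel.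
have ha := h_neq0 a Ux.
by field.
Qed.

(** The part of the Riemann tensor that is still to be antisymmetrised in [c] and [e]: the
    derivative of a Christoffel symbol plus a product of two. The Kronecker deltas stay explicit, so
    that components can be read off by cases on coinciding indices. *)
Definition diag_curvature (a b c e : 'I_D) (x : point) : R :=
  (a == b)%:R * mu a e c x + (a == e)%:R * mu a b c x
  - (e == b)%:R * (h e x / h a x *
      (2 * lam e c x * lam e a x - 2 * lam a c x * lam e a x + mu e a c x))
  + (a == b)%:R * (lam a c x * lam a e x)
  + (a == e)%:R * (lam a c x * lam a b x)
  - (e == b)%:R * (lam a c x * (h e x / h a x) * lam e a x)
  + (a == c)%:R * (lam a b x * lam b e x + lam a e x * lam e b x)
  - (a == c)%:R * (e == b)%:R *
      \sum_k lam a k x * (h e x / h k x) * lam e k x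
  - (c == b)%:R * (h c x / h a x * lam c a x * lam c e x)
  - (c == e)%:R * (h c x / h a x * lam c a x * lam c b x)
  + (e == b)%:R * (h c x / h a x * lam c a x * (h e x / h c x * lam e c x)).

Lemma is_derive_christoffel x a b c e : U x ->
  is_derive x (delta_mx 0 c : point) (christoffel g a e b)
   ((a == b)%:R * mu a e c x + (a == e)%:R * mu a b c x
  - (e == b)%:R * (h e x / h a x *
      (2 * lam e c x * lam e a x - 2 * lam a c x * lam e a x + mu e a c x))).
Proof.
move=> Ux.
have ha := h_neq0 a Ux.
have cstD k := is_derive_cst (k : R) x (delta_mx 0 c : point).
have D1 := is_derive_mul (cstD (a == b)%:R) (dlam a e c Ux).
have D2 := is_derive_mul (cstD (a == e)%:R) (dlam a b c Ux).
have D3 := is_derive_mul (cstD (e == b)%:R) (is_derive_mul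
  (is_derive_mul (dh e c Ux) (dlam e a c Ux)) (is_derive_inv ha (dh a c Ux))).
have DD := is_derive_add (is_derive_add D1 D2) (is_derive_opp D3).
apply: (@is_derive_near _ _ _ _ _ (diag_christoffel a e b)) oU Ux _ _.
  by move=> y Uy; rewrite christoffel_diag.
by apply: is_derive_eq DD _; rewrite /cst; field.
Qed.

Lemma christoffel_sum x a b c e : U x ->
  \sum_k diag_christoffel a c k x * diag_christoffel k e b x =
  (a == b)%:R * (lam a c x * lam a e x)
  + (a == e)%:R * (lam a c x * lam a b x)
  - (e == b)%:R * (lam a c x * (h e x / h a x) * lam e a x)
  + (a == c)%:R * (lam a b x * lam b e x + lam a e x * lam e b x)
  - (a == c)%:R * (e == b)%:R *
      \sum_k lam a k x * (h e x / h k x) * lam e k x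
  - (c == b)%:R * (h c x / h a x * lam c a x * lam c e x)
  - (c == e)%:R * (h c x / h a x * lam c a x * lam c b x)
  + (e == b)%:R * (h c x / h a x * lam c a x * (h e x / h c x * lam e c x)).
Proof.
move=> Ux.
(* Every product of Christoffel terms carries a Kronecker delta in [k] that collapses the sum,
   except [s4], whose deltas involve only free indices. *)
pose s1 k := (a == k)%:R * (lam a c x * diag_christoffel k e b x).
pose s2 k := (b == k)%:R * ((a == c)%:R * lam a k x * lam k e x).
pose s3 k := (e == k)%:R * ((a == c)%:R * lam a k x * lam k b x).
pose s4 k := (a == c)%:R * (e == b)%:R * (lam a k x * (h e x / h k x) * lam e k x).
pose s5 k := (c == k)%:R * (h c x / h a x * lam c a x * diag_christoffel k e b x).
rewrite (eq_bigr (fun k => s1 k + s2 k + s3 k - s4 k - s5 k)); last first.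
  move=> k _; rewrite /s1 /s2 /s3 /s4 /s5 /diag_christoffel.
  by rewrite (eq_sym k b) (eq_sym k e); ring.
rewrite !big_split /= !sumrN !sum_delta -big_distrr /= /diag_christoffel.
by rewrite (eq_sym e b) ; ring.
Qed.

Lemma riemann_up_diag x a b c e : U x ->
  riemann_up g a b c e x = diag_curvature a b c e x - diag_curvature a b e c x.
Proof.
move=> Ux; rewrite /riemann_up /partial.
rewrite (is_derive_val (is_derive_christoffel a b c e Ux)).
rewrite (is_derive_val (is_derive_christoffel a b e c Ux)).
under eq_bigr do rewrite !christoffel_diag //.
rewrite big_split /= sumrN !christoffel_sum // /diag_curvature.
by ring.
Qed.

(** For [a != b] this is the component R^a_{bab} without summation: [h b] times the sectional
    curvature of the coordinate plane of [a] and [b]. *)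
Definition diag_sectional (a b : 'I_D) (x : point) : R :=
  - (h b x / h a x) * (lam b a x ^+ 2 - 2 * lam a a x * lam b a x + mu b a a x)
  + 2 * lam a b x * lam b b x - mu a b b x - lam a b x ^+ 2
  - \sum_k lam a k x * (h b x / h k x) * lam b k x.

(** Components with four distinct indices vanish for every diagonal metric; the last hypothesis
    kills those with three, which leaves the coordinate planes. Symmetry of [mu], the equality of
    mixed partial derivatives, makes components with equal first two indices vanish. *)
Lemma riemann_diag x : U x ->
  (forall a b c, mu a b c x = mu a c b x) ->
  (forall a b e, a != b -> a != e -> b != e ->
     lam a b x * lam b e x + lam a e x * lam e b x
     - mu a b e x - lam a e x * lam a b x = 0) ->
  forall a b c e, riemann g a b c e x =
    h a x * (diag_sectional a b x * ((a == c) && (b == e))%:R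
             - diag_sectional a b x * ((a == e) && (b == c))%:R) *+ (a != b).
Proof.
move=> Ux mus off a b c e.
have -> : riemann g a b c e x = h a x * riemann_up g a b c e x.
  rewrite /riemann -(sum_delta a (fun k => h k x * riemann_up g k b c e x)).
  apply: eq_bigr => k _; rewrite gE !mxE mulrA; congr (_ * _).
  by case: eqP => [->|]; rewrite ?mul1r ?mul0r.
rewrite riemann_up_diag //.
have hn k : h k x != 0 by exact: h_neq0.
have [->|ab] := eqVneq a b.
  rewrite mulr0n /diag_curvature (mus b e c).
  have [->|ce] := eqVneq c e; first by rewrite subrr mulr0.
  have [bc|bc] := eqVneq b c; [subst c|]; have [be|be] := eqVneq b e; try subst e;
    simpl_neq; field; rewrite ?hn //.
rewrite mulr1n; have [->|ce] := eqVneq c e.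
  by rewrite subrr mulr0 subrr mulr0.
rewrite /diag_curvature.
have [ac|ac] := eqVneq a c; [subst c|].
  have [be|be] := eqVneq b e; [subst e|].
    by simpl_neq; rewrite /diag_sectional; field; rewrite ?hn.
  simpl_neq.
  have X := off a b e ab ce be.
  apply: (@eq_trans _ _ (h a x * (lam a b x * lam b e x + lam a e x * lam e b x
     - mu a b e x - lam a e x * lam a b x))); last by rewrite X; ring.
  by ring.
have [ae|ae] := eqVneq a e; [subst e|].
  have [bc|bc] := eqVneq b c; [subst c|].
    by simpl_neq; rewrite /diag_sectional; field; rewrite ?hn.
  simpl_neq.
  have X := off a b c ab ac bc.
  apply: (@eq_trans _ _ (- h a x * (lam a b x * lam b c x + lam a c x * lam c b x
     - mu a b c x - lam a c x * lam a b x))); last by rewrite X; ring.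
  by ring.
have [bc|bc] := eqVneq b c; [subst c|].
  have ba : b != a by rewrite eq_sym.
  have X := off b a e ba ce ae.
  simpl_neq.
  apply: (@eq_trans _ _ (- h b x * (lam b a x * lam a e x + lam b e x * lam e a x
     - mu b a e x - lam b e x * lam b a x))); last by rewrite X; ring.
  by field; rewrite ?hn.
have [be|be] := eqVneq b e; [subst e|].
  have ba : b != a by rewrite eq_sym.
  have X := off b a c ba bc ac.
  simpl_neq.
  apply: (@eq_trans _ _ (h b x * (lam b a x * lam a c x + lam b c x * lam c a x
     - mu b a c x - lam b c x * lam b a x))); last by rewrite X; ring.
  by field; rewrite ?hn.
by simpl_neq; ring.
Qed.

End DiagonalMetric.

(** * Smooth radial profiles *)

Section SmoothProfiles.
Context {R : realType}.

Lemma smooth_derive1 (I : set R) (f : R -> R) :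
  smooth_on I f -> smooth_on I (derive1 f).
Proof.
move=> sf k; have [_ /(_ 1)[_ +]] := sf k.+1.
by have -> : derive1 f = 'D_1 f by apply/funext => r; rewrite derive1E.
Qed.

Lemma smooth_is_derive (I : set R) (f : R -> R) r :
  smooth_on I f -> I r -> is_derive r 1 f (derive1 f r).
Proof.
move=> sf Ir; have [_ /(_ 1)[df _]] := sf 1.
by rewrite derive1E; apply: derivableP; exact: df.
Qed.

End SmoothProfiles.

(** * Curvature of the static spherically symmetric metrics *)

Section SphericalCurvature.
Context {R : realType} {d : nat}.
Local Notation D := d.+2.
Local Notation point := 'rV[R]_D.

(* Sectional curvatures: [A] on the (t, r) plane, [B] on the planes spanned by
   one of t, r and one direction of the sphere, [psi] on the planes tangent to
   the sphere.  The diagonal is set to 0. *)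
Definition sectional (A B psi : R) (a b : 'I_D) : R :=
  if a == b then 0 else
  if (a < 2)%N then (if (b < 2)%N then A else B)
  else (if (b < 2)%N then B else psi).

Definition pair_sign (a b c e : 'I_D) : R :=
  ((a == c) && (b == e))%:R - ((a == e) && (b == c))%:R.

Definition diagonal_point (g : @metric_field R d) (x : point)
    (h : 'I_D -> R) (K : 'I_D -> 'I_D -> R) : Prop :=
  [/\ g x = diag_mx (\row_i h i), forall i, h i != 0 &
      forall a b c e,
        riemann g a b c e x = h a * h b * K a b * pair_sign a b c e].

Variables (I : set R) (f : R -> R).
Hypothesis I_radial : radial_domain I.
Hypothesis f_adm : admissible_profile I f.

Local Notation r x := (x 0 1 : R).
Local Notation U := [set x : point | I (r x)].

Definition sphere_norm2 (x : point) : R := \sum_(i < D | (1 < i)%N) x 0 i ^+ 2.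
Local Notation rho2 := sphere_norm2.

Definition sss_entry (i : 'I_D) (x : point) : R :=
  match nat_of_ord i with
  | 0%N => - f (r x)
  | 1%N => (f (r x))^-1
  | _ => r x ^+ 2 * (4 * ((1 + rho2 x) ^+ 2)^-1)
  end.

Definition log_derivative (a b : 'I_D) (x : point) : R :=
  match nat_of_ord a, nat_of_ord b with
  | 0%N, 1%N => derive1 f (r x) * (f (r x))^-1 * 2^-1
  | 1%N, 1%N => - (derive1 f (r x) * (f (r x))^-1 * 2^-1)
  | _.+2, 1%N => (r x)^-1
  | _.+2, _.+2 => - (2 * (1 + rho2 x)^-1 * x 0 b)
  | _, _ => 0
  end.

Definition log_derivative2 (a b c : 'I_D) (x : point) : R :=
  match nat_of_ord a, nat_of_ord b, nat_of_ord c with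
  | 0%N, 1%N, 1%N =>
      (derive1 (derive1 f) (r x) / f (r x) - derive1 f (r x) ^+ 2 / f (r x) ^+ 2) / 2
  | 1%N, 1%N, 1%N =>
      - ((derive1 (derive1 f) (r x) / f (r x) - derive1 f (r x) ^+ 2 / f (r x) ^+ 2) / 2)
  | _.+2, 1%N, 1%N => - (r x) ^- 2
  | _.+2, _.+2, _.+2 =>
      - (2 / (1 + rho2 x)) * (b == c)%:R + 4 / (1 + rho2 x) ^+ 2 * x 0 b * x 0 c
  | _, _, _ => 0
  end.

Lemma open_radial : open U.
Proof.
have [oI _] := I_radial.
apply: (@open_comp point R (fun x => r x)) => //.
by move=> x _; exact: coord_continuous.
Qed.

Lemma r_neq0 x : U x -> r x != 0.
Proof. by have [_ p] := I_radial; move=> /p; rewrite lt0r => /andP[]. Qed.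

Lemma f_neq0 x : U x -> f (r x) != 0.
Proof. by have [_ p] := f_adm; move=> /p. Qed.

Lemma rho2_ge0 x : 0 <= rho2 x.
Proof. by apply: sumr_ge0 => i _; exact: sqr_ge0. Qed.

Lemma rho2_neq0 x : 1 + rho2 x != 0.
Proof. by rewrite gt_eqF // ltr_pwDl // rho2_ge0. Qed.

Lemma sss_metricE x : sss_metric (fun=> 1) f x = diag_mx (\row_i sss_entry i x).
Proof.
rewrite /sss_metric; congr diag_mx; apply/rowP => i; rewrite !mxE /sss_entry -[val i]/(nat_of_ord i).
by case: (nat_of_ord i) => [|[|n]] //; rewrite expr1n mul1r.
Qed.

Lemma sss_entry_neq0 x i : U x -> sss_entry i x != 0.
Proof.
move=> Ux; rewrite /sss_entry; case: (nat_of_ord i) => [|[|n]].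
- by rewrite oppr_eq0 f_neq0.
- by rewrite invr_eq0 f_neq0.
- rewrite !mulf_neq0 ?invr_eq0 ?expf_neq0 ?rho2_neq0 ?r_neq0 //.
Qed.

Local Notation e_ b := (delta_mx 0 b : point).

Lemma is_derive_r x b : is_derive x (e_ b) (fun y : point => r y) (b == 1)%:R.
Proof.
have := is_derive_coord x (e_ b) 1 => H; apply: is_derive_eq H _.
by rewrite mxE eqxx eq_sym.
Qed.

Lemma is_derive_comp_r (F : R -> R) (x : point) b l : is_derive (r x) 1 F l ->
  is_derive x (e_ b) (fun y : point => F (r y)) ((b == 1)%:R * l).
Proof.
move=> dF; have := is_derive_coord_comp (e_ b) dF => H; apply: is_derive_eq H _.
by rewrite mxE eqxx /= eq_sym.
Qed.

Lemma is_derive_rho2 x b :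
  is_derive x (e_ b) rho2 ((1 < b)%N%:R * (2 * x 0 b)).
Proof.
have H := @is_derive_bigsum _ _ _ (index_enum _) (fun i : 'I_D => (1 < i)%N) x (e_ b)
  (fun i y => y 0 i ^+ 2) _ (fun i _ => is_derive_pow 2 (is_derive_coord x (e_ b) i)).
apply: is_derive_eq H _.
have [b1|b1] := boolP (1 < b)%N.
  rewrite (bigD1 b) //= big1 ?addr0; last first.
    by move=> i /andP[_ ib]; rewrite mxE (negbTE ib) andbF mulr0.
  by rewrite mxE !eqxx expr1 mulr1 mul1r.
rewrite big1 ?mul0r // => i i1; rewrite mxE.
case: (eqVneq i b) => [ib|]; last by rewrite andbF mulr0.
by rewrite -ib i1 in b1.
Qed.

Lemma eq_one (b : 'I_D) : (b == 1) = (nat_of_ord b == 1%N).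
Proof. by []. Qed.

Lemma is_derive_entry x i b : U x ->
  is_derive x (e_ b) (sss_entry i) (2 * sss_entry i x * log_derivative i b x).
Proof.
move=> Ux.
have [[f0 r0] q0] := (f_neq0 Ux, r_neq0 Ux, rho2_neq0 x).
have df := is_derive_comp_r b (smooth_is_derive f_adm.1 Ux).
have dr := is_derive_r x b.
have dq := is_derive_pow 2 (is_derive_add (is_derive_cst (1 : R) x (e_ b)) (is_derive_rho2 x b)).
have q20 : (1 + rho2 x) ^+ 2 != 0 by rewrite expf_neq0.
have dqi := @is_derive_inv _ _ x (e_ b) (fun y => (1 + rho2 y) ^+ 2) _ q20 dq.
rewrite /sss_entry /log_derivative.
case: (nat_of_ord i) => [|[|n]].
- apply: is_derive_eq (is_derive_opp df) _; rewrite eq_one.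
  by case: (nat_of_ord b) => [|[|m]] /=; field.
- apply: is_derive_eq (@is_derive_inv _ _ x (e_ b) (fun y => f (r y)) _ f0 df) _; rewrite eq_one.
  by case: (nat_of_ord b) => [|[|m]] /=; field.
- apply: is_derive_eq (is_derive_mul (is_derive_pow 2 dr)
    (is_derive_mul (is_derive_cst (4 : R) x (e_ b)) dqi)) _.
  rewrite /cst eq_one.
  by case: (nat_of_ord b) => [|[|m]] /=; field; rewrite ?r0.
Qed.

Lemma is_derive_log x a b c : U x ->
  is_derive x (e_ c) (log_derivative a b) (log_derivative2 a b c x).
Proof.
move=> Ux.
have [[f0 r0] q0] := (f_neq0 Ux, r_neq0 Ux, rho2_neq0 x).
have df := is_derive_comp_r c (smooth_is_derive f_adm.1 Ux).
have ddf := is_derive_comp_r c (smooth_is_derive (smooth_derive1 f_adm.1) Ux).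
have dr := is_derive_r x c.
have dq := is_derive_add (is_derive_cst (1 : R) x (e_ c)) (is_derive_rho2 x c).
have d0 := is_derive_cst (0 : R) x (e_ c).
have d2 := is_derive_cst (2 : R) x (e_ c).
have d2i := is_derive_cst (2^-1 : R) x (e_ c).
have dp := is_derive_mul (is_derive_mul ddf (@is_derive_inv _ _ x (e_ c) (fun y => f (r y)) _ f0 df)) d2i.
rewrite /log_derivative /log_derivative2.
case: (nat_of_ord a) => [|[|n]]; case Eb : (nat_of_ord b) => [|[|m]]; try by
  apply: is_derive_eq d0 _; case: (nat_of_ord c) => [|[|k]].
- apply: is_derive_eq dp _; rewrite /cst eq_one.
  by case: (nat_of_ord c) => [|[|m]] /=; field.
- apply: is_derive_eq (is_derive_opp dp) _; rewrite /cst eq_one.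
  by case: (nat_of_ord c) => [|[|m]] /=; field.
- apply: is_derive_eq (@is_derive_inv _ _ x (e_ c) (fun y => r y) _ r0 dr) _; rewrite eq_one.
  by case: (nat_of_ord c) => [|[|k]] /=; field.
- apply: is_derive_eq (is_derive_opp (is_derive_mul
    (is_derive_mul d2 (@is_derive_inv _ _ x (e_ c) (fun y => 1 + rho2 y) _ q0 dq)) (is_derive_coord x (e_ c) b))) _.
  rewrite /cst mxE eqxx /=.
  have -> : (b == c) = (nat_of_ord b == nat_of_ord c) by [].
  by rewrite Eb; case: (nat_of_ord c) => [|[|k]] /=; field.
Qed.

Lemma sum_ord2 (F : 'I_D -> R) :
  \sum_k F k = F 0 + F 1 + \sum_(k < D | (1 < k)%N) F k.
Proof.
rewrite (bigD1 0) // (bigD1 1) //= addrA; congr (_ + _).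
by apply: eq_bigl => -[[|[|k]] kD].
Qed.

Lemma sss_diagonal_point x : U x ->
  diagonal_point (sss_metric (fun=> 1) f) x (sss_entry^~ x)
    (sectional (- derive1 (derive1 f) (r x) / 2) (- derive1 f (r x) / (2 * r x))
       ((1 - f (r x)) / r x ^+ 2)).
Proof.
move=> Ux; split.
- exact: sss_metricE.
- by move=> i; exact: sss_entry_neq0.
have [[f0 r0] q0] := (f_neq0 Ux, r_neq0 Ux, rho2_neq0 x).
have q20 : (1 + rho2 x) ^+ 2 != 0 by rewrite expf_neq0.
move=> a b c e.
rewrite (@riemann_diag _ _ _ U sss_entry log_derivative log_derivative2
  open_radial sss_metricE sss_entry_neq0 is_derive_entry is_derive_log x Ux); first last.
- move=> a' b' e' ab ae be; rewrite /log_derivative /log_derivative2.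
  have nb : (b' == e') = false by exact/negbTE.
  rewrite nb.
  have := ab; have := ae; have := be; rewrite -!val_eqE /=.
  case: (nat_of_ord a') => [|[|k]]; case: (nat_of_ord b') => [|[|l]]; case: (nat_of_ord e') => [|[|m]] //= _ _ _;
  field; by rewrite ?q0 ?r0 ?f0.
- move=> a' b' c'; rewrite /log_derivative2 (eq_sym c' b').
  by case: (nat_of_ord a') => [|[|k]]; case: (nat_of_ord b') => [|[|l]]; case: (nat_of_ord c') => [|[|m]] //=; ring.
rewrite /sectional; case: ifPn => ab; first by rewrite mulr0n !mulr0 mul0r.
rewrite mulr1n -mulrBr -/(pair_sign a b c e) mulrA; congr (_ * _).
rewrite -mulrA; congr (_ * _).
rewrite /diag_sectional sum_ord2.
set S := \sum_(k < D | _) _.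
(* Summing over the sphere directions produces [rho2]; for [b] on the sphere the quotient of metric
   entries is 1. Together with the derivatives of the conformal factor this gives the curvature 1 of
   the unit sphere. *)
have SE : S = ((1 < a)%N && (1 < b)%N)%:R * (4 / (1 + rho2 x) ^+ 2 * rho2 x
   * sss_entry b x / (r x ^+ 2 * (4 * ((1 + rho2 x) ^+ 2)^-1))).
  rewrite /S /log_derivative; case Ea : (nat_of_ord a) => [|[|m]]; rewrite ?mul0r.
  - by apply: big1 => -[[|[|k]] kD] //=; rewrite !mul0r.
  - by apply: big1 => -[[|[|k]] kD] //=; rewrite !mul0r.
  case Eb : (nat_of_ord b) => [|[|l]]; rewrite /= ?mul0r.
  - by apply: big1 => -[[|[|k]] kD] //=; rewrite !mulr0.
  - by apply: big1 => -[[|[|k]] kD] //=; rewrite !mulr0.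
  rewrite [X in _ = 1 * (_ * X * _ / _)]/sphere_norm2 mul1r mulr_sumr !mulr_suml.
  apply: eq_bigr => k k1; rewrite /sss_entry Eb.
  case Ek : (nat_of_ord k) k1 => [|[|j]] // _.
  by field; rewrite ?q0 ?r0.
rewrite {}SE.
have := ab; rewrite -val_eqE /= /sss_entry /log_derivative /log_derivative2 !eqxx.
case Ea : (nat_of_ord a) => [|[|m]]; case Eb : (nat_of_ord b) => [|[|l]] //= _;
  by field; rewrite ?q0 ?r0 ?f0.
Qed.

End SphericalCurvature.

(** * Contractions at points with diagonal metric *)

Section DiagonalTensors.
Context {R : realType} {d : nat}.
Local Notation D := d.+2.
Local Notation point := 'rV[R]_D.
Local Notation curvature := (curvature_tensor (R := R) (d := d) false).

(** A condition at one point is enough: without covariant derivatives the tensors depend only on the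
    metric and the curvature at that point. Invertibility lets the lowered index of [riemann] be
    raised again. *)
Definition ricci_flat_at (g : @metric_field R d) (x : point) : Prop :=
  g x \in unitmx /\ forall b c, ricci g b c x = 0.

Lemma diagonal_inverse (g : @metric_field R d) (x : point) h K (u v : 'I_D) :
  diagonal_point g x h K ->
  inverse_metric g u v x = (u == v)%:R * (h u)^-1.
Proof.
case=> gE h0 _; rewrite /inverse_metric gE invmx_diag // !mxE mulr_natl.
by case: eqP.
Qed.

Lemma diagonal_contract (T : tensor) (g : @metric_field R d) (x : point) h K s :
  diagonal_point g x h K ->
  contract_indices T g s x = \sum_u (h u)^-1 * T g [:: u, u & s] x.
Proof.
move=> gx; apply: eq_bigr => u _; rewrite -[RHS](sum_delta u (fun v => (h u)^-1 * T g [:: u, v & s] x)).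
by apply: eq_bigr => v _; rewrite (diagonal_inverse _ _ gx) mulrA.
Qed.

(* In the three predicates below the functions give the value at a point where
   the metric is diagonal with sectional curvatures [A], [B], [psi]; the flag
   records that the tensor vanishes wherever the Ricci tensor does. *)
Definition scalar_curv (v : bool) (n : nat) (p : R -> R -> R -> R) : Prop :=
  exists T, [/\ curvature n.*2 0 T,
    v -> forall g x, ricci_flat_at g x -> T g [::] x = 0 &
    forall g x h A B psi, diagonal_point g x h (sectional A B psi) ->
      T g [::] x = p A B psi].

Definition pick_block (a : 'I_D) (x y : R) : R := if (a < 2)%N then x else y.

Definition diagonal_curv (v : bool) (n : nat) (p q : R -> R -> R -> R) : Prop :=
  exists T, [/\ curvature n.*2 2 T,
    v -> forall g x, ricci_flat_at g x -> forall a b, T g [:: a; b] x = 0 &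
    forall g x h A B psi, diagonal_point g x h (sectional A B psi) ->
      forall a b, T g [:: a; b] x =
        (a == b)%:R * (h a * pick_block a (p A B psi) (q A B psi))].

Definition sectional_curv (v : bool) (n : nat) (p q s : R -> R -> R -> R) : Prop :=
  exists T, [/\ curvature n.*2 4 T,
    v -> forall g x, ricci_flat_at g x -> forall a b c e, T g [:: a; b; c; e] x = 0 &
    forall g x h A B psi, diagonal_point g x h (sectional A B psi) ->
      forall a b c e, T g [:: a; b; c; e] x =
        h a * h b * sectional (p A B psi) (q A B psi) (s A B psi) a b
        * pair_sign a b c e].

Lemma scalar_curv_ext v n p q : scalar_curv v n p ->
  (forall A B psi, p A B psi = q A B psi) -> scalar_curv v n q.
Proof.
move=> [T [cT vT pT]] pq; exists T; split => // g x h A B psi gx.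
by rewrite (pT _ _ _ _ _ _ gx) pq.
Qed.

Lemma scalar_curv_add v n p q : scalar_curv v n p -> scalar_curv v n q ->
  scalar_curv v n (fun A B psi => p A B psi + q A B psi).
Proof.
move=> [T [cT vT pT]] [S [cS vS pS]]; exists (fun g s x => T g s x + S g s x).
split; first exact: ct_add.
- by move=> /[dup] /vT {}vT /vS {}vS g x fl; rewrite vT // vS // addr0.
- by move=> g x h A B psi gx; rewrite (pT _ _ _ _ _ _ gx) (pS _ _ _ _ _ _ gx).
Qed.

Lemma scalar_curv_scale v n p a : scalar_curv v n p ->
  scalar_curv v n (fun A B psi => a * p A B psi).
Proof.
move=> [T [cT vT pT]]; exists (fun g s x => a * T g s x).
split; first exact: ct_scale.
- by move=> /vT {}vT g x fl; rewrite vT // mulr0.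
- by move=> g x h A B psi gx; rewrite (pT _ _ _ _ _ _ gx).
Qed.

Lemma scalar_curv_mul v w n m p q : scalar_curv v n p -> scalar_curv w m q ->
  scalar_curv (v || w) (n + m) (fun A B psi => p A B psi * q A B psi).
Proof.
move=> [T [cT vT pT]] [S [cS vS pS]]; exists (tensor_product 0 T S).
split; first by rewrite doubleD; exact: ct_product cT cS.
- move=> /orP[/vT {}vT|/vS {}vS] g x fl; rewrite /tensor_product /=.
    by rewrite vT // mul0r.
  by rewrite vS // mulr0.
- by move=> g x h A B psi gx; rewrite /tensor_product /= (pT _ _ _ _ _ _ gx) (pS _ _ _ _ _ _ gx).
Qed.

Lemma diagonal_curv_ext v n p q p' q' : diagonal_curv v n p q ->
  (forall A B psi, p A B psi = p' A B psi) ->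
  (forall A B psi, q A B psi = q' A B psi) -> diagonal_curv v n p' q'.
Proof.
move=> [T [cT vT pT]] pp qq; exists T; split => // g x h A B psi gx a b.
by rewrite (pT _ _ _ _ _ _ gx) pp qq.
Qed.

Lemma pick_blockD a x y z t :
  pick_block a (x + z) (y + t) = pick_block a x y + pick_block a z t.
Proof. by rewrite /pick_block; case: ifP. Qed.

Lemma pick_blockM a x y z t :
  pick_block a (x * z) (y * t) = pick_block a x y * pick_block a z t.
Proof. by rewrite /pick_block; case: ifP. Qed.

Lemma pick_blockZ a c x y : pick_block a (c * x) (c * y) = c * pick_block a x y.
Proof. by rewrite /pick_block; case: ifP. Qed.

Lemma diagonal_curv_add v n p q p' q' :
  diagonal_curv v n p q -> diagonal_curv v n p' q' ->
  diagonal_curv v n (fun A B psi => p A B psi + p' A B psi)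
    (fun A B psi => q A B psi + q' A B psi).
Proof.
move=> [T [cT vT pT]] [S [cS vS pS]]; exists (fun g s x => T g s x + S g s x).
split; first exact: ct_add.
- by move=> /[dup] /vT {}vT /vS {}vS g x fl a b; rewrite vT // vS // addr0.
- move=> g x h A B psi gx a b; rewrite (pT _ _ _ _ _ _ gx) (pS _ _ _ _ _ _ gx).
  by rewrite pick_blockD !mulrDr.
Qed.

Lemma diagonal_curv_scale v n p q c : diagonal_curv v n p q ->
  diagonal_curv v n (fun A B psi => c * p A B psi) (fun A B psi => c * q A B psi).
Proof.
move=> [T [cT vT pT]]; exists (fun g s x => c * T g s x).
split; first exact: ct_scale.
- by move=> /vT {}vT g x fl a b; rewrite vT // mulr0.
- by move=> g x h A B psi gx a b; rewrite (pT _ _ _ _ _ _ gx) pick_blockZ; ring.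
Qed.

Lemma diagonal_curv_scalar v w n m s p q : scalar_curv v n s ->
  diagonal_curv w m p q ->
  diagonal_curv (v || w) (n + m) (fun A B psi => s A B psi * p A B psi)
    (fun A B psi => s A B psi * q A B psi).
Proof.
move=> [T [cT vT pT]] [S [cS vS pS]]; exists (tensor_product 0 T S).
split; first by rewrite doubleD; exact: (ct_product cT cS).
- move=> /orP[/vT {}vT|/vS {}vS] g x fl a b; rewrite /tensor_product /=.
    by rewrite vT // mul0r.
  by rewrite vS // mulr0.
- move=> g x h A B psi gx a b.
  by rewrite /tensor_product /= (pT _ _ _ _ _ _ gx) (pS _ _ _ _ _ _ gx) pick_blockZ; ring.
Qed.

Lemma diagonal_curv_metric : diagonal_curv false 0 (fun _ _ _ => 1) (fun _ _ _ => 1).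
Proof.
exists (@metric_tensor R d); split => //; first exact: ct_metric.
move=> g x h A B psi [gE _ _] a b; rewrite /= gE !mxE /pick_block if_same mulr1.
by rewrite mulr_natl; case: eqP.
Qed.

(** This is the matrix product: the permutation brings the two inner indices to the front, where
    [contract_indices] acts. *)
Lemma diagonal_curv_mul v w n m p q p' q' :
  diagonal_curv v n p q -> diagonal_curv w m p' q' ->
  diagonal_curv (v || w) (n + m) (fun A B psi => p A B psi * p' A B psi)
    (fun A B psi => q A B psi * q' A B psi).
Proof.
move=> [T [cT vT pT]] [S [cS vS pS]].
exists (contract_indices (permute_indices [:: 2; 0; 1; 3] (tensor_product 2 T S))).
split.
- rewrite doubleD; apply: ct_contraction; apply: ct_permute => //.
  exact: ct_product cT cS.
- move=> /orP[/vT {}vT|/vS {}vS] g x fl a b; apply: big1 => u _; apply: big1 => u' _.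
    by rewrite /permute_indices /tensor_product /= vT // mul0r mulr0.
  by rewrite /permute_indices /tensor_product /= vS // !mulr0.
- move=> g x h A B psi gx a b; rewrite (diagonal_contract _ _ gx).
  rewrite /permute_indices /tensor_product /=.
  under eq_bigr do rewrite (pT _ _ _ _ _ _ gx) (pS _ _ _ _ _ _ gx).
  case: gx => _ h0 _.
  rewrite pick_blockM (eq_bigr (fun u => (a == u)%:R * ((u == b)%:R * (h a
    * (pick_block a (p A B psi) (q A B psi) * pick_block u (p' A B psi) (q' A B psi)))))).
    by rewrite sum_delta.
  by move=> u _; have := h0 u => hu; field.
Qed.

Lemma sum_blocks (x y : R) : \sum_(a < D) pick_block a x y = 2 * x + d%:R * y.
Proof.
rewrite 2!big_ord_recl /= addrA; congr (_ + _).
  by rewrite /pick_block /=; ring.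
under eq_bigr do rewrite /pick_block /=.
by rewrite sumr_const card_ord mulr_natl.
Qed.

Lemma diagonal_curv_trace v n p q : diagonal_curv v n p q ->
  scalar_curv v n (fun A B psi => 2 * p A B psi + d%:R * q A B psi).
Proof.
move=> [T [cT vT pT]]; exists (contract_indices T); split.
- exact: ct_contraction.
- move=> /vT {}vT g x fl; apply: big1 => u _; apply: big1 => w _.
  by rewrite vT // mulr0.
- move=> g x h A B psi gx; rewrite (diagonal_contract _ _ gx).
  under eq_bigr do rewrite (pT _ _ _ _ _ _ gx) eqxx mul1r.
  rewrite -sum_blocks; apply: eq_bigr => u _.
  by case: gx => _ h0 _; rewrite mulKf.
Qed.

Lemma sectional_sym A B psi (a b : 'I_D) :
  sectional A B psi a b = sectional A B psi b a :> R.
Proof. by rewrite /sectional (eq_sym b); do 3 case: ifP => //. Qed.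

Lemma sectional_diag A B psi (a : 'I_D) : sectional A B psi a a = 0 :> R.
Proof. by rewrite /sectional eqxx. Qed.

Lemma pair_signE (a b c e : 'I_D) :
  pair_sign a b c e = (a == c)%:R * (b == e)%:R - (a == e)%:R * (b == c)%:R :> R.
Proof. by rewrite /pair_sign -!mulnb !natrM. Qed.

(** With a zero diagonal the sum runs over the directions other than [a]; it is the sum over all
    directions of a function constant on blocks, minus its value at [a]. *)
Lemma sectional_row (A B psi x y : R) (a : 'I_D) :
  \sum_u sectional A B psi u a * pick_block u x y =
  pick_block a (A * x + d%:R * (B * y)) (2 * (B * x) + (d%:R - 1) * (psi * y)).
Proof.
pose c := pick_block a A psi; pose f u := pick_block u (pick_block a A B * x) (pick_block a B psi * y).
rewrite (eq_bigr (fun u => f u - (a == u)%:R * f u)); last first.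
  move=> u _; rewrite /f /sectional /pick_block (eq_sym a); case: eqP => [->|_].
    by rewrite !mul0r mul1r subrr.
  by rewrite mul0r subr0; do 2 case: ifP => _.
rewrite big_split /= sumrN sum_delta sum_blocks /f /pick_block.
by case: ifP => _; ring.
Qed.

Lemma sectional_pair (K : 'I_D -> 'I_D -> R) (F : 'I_D -> R) a b : K a a = 0 ->
  \sum_u K u a * pair_sign u a u b * F u = (a == b)%:R * \sum_u K u a * F u.
Proof.
move=> K0; rewrite mulr_sumr; apply: eq_bigr => u _; rewrite /pair_sign eqxx /=.
have [->|ua] := eqVneq u a; first by rewrite K0; ring.
by rewrite andbF subr0; ring.
Qed.

Lemma diagonal_curv_ricci : diagonal_curv true 1
  (fun A B psi => A + d%:R * B) (fun A B psi => 2 * B + (d%:R - 1) * psi).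
Proof.
exists (contract_indices (permute_indices [:: 1; 2; 0; 3]%N (@riemann_tensor R d))).
split.
- by apply: ct_contraction; apply: ct_permute => //; exact: ct_riemann.
- move=> _ g x [gU r0] a b; rewrite -[RHS](r0 a b) /contract_indices /ricci.
  rewrite /permute_indices /=; apply: eq_bigr => u _; rewrite /riemann.
  under eq_bigr do rewrite mulr_sumr.
  rewrite exchange_big /= -[RHS](sum_delta u (fun k => riemann_up g k a u b x)).
  apply: eq_bigr => k _; under eq_bigr do rewrite mulrA.
  rewrite -mulr_suml; congr (_ * _).
  have := congr1 (fun M : 'M[R]_D => M u k) (mulVmx gU).
  by rewrite !mxE.
- move=> g x h A B psi gx a b; rewrite (diagonal_contract _ _ gx) /permute_indices /=.
  case: gx => _ h0 rE.
  rewrite (eq_bigr (fun u => h a * (sectional A B psi u a * pair_sign u a u b * pick_block u 1 1))).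
    rewrite -mulr_sumr sectional_pair ?sectional_diag // sectional_row !mulr1.
    by ring.
  move=> u _; rewrite rE /pick_block if_same; have := h0 u => hu; field.
  by rewrite hu.
Qed.

(** The witness is T_{kaub} S^{ku}, the action of a curvature-like tensor on symmetric tensors. With
    S the metric it is the Ricci contraction of T. *)
Lemma diagonal_curv_apply v w n m p q s p' q' :
  sectional_curv v n p q s -> diagonal_curv w m p' q' ->
  diagonal_curv (v || w) (n + m)
    (fun A B psi => p A B psi * p' A B psi + d%:R * (q A B psi * q' A B psi))
    (fun A B psi => 2 * (q A B psi * p' A B psi)
                    + (d%:R - 1) * (s A B psi * q' A B psi)).
Proof.
move=> [T [cT vT pT]] [S [cS vS pS]].
exists (contract_indices (contract_indices (permute_indices [:: 0; 4; 2; 5; 1; 3]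
  (tensor_product 4 T S)))).
split.
- rewrite doubleD; do 2 apply: ct_contraction; apply: ct_permute => //.
  exact: ct_product cT cS.
- move=> /orP[/vT {}vT|/vS {}vS] g x fl a b;
  apply: big1 => u _; apply: big1 => u' _; rewrite [X in _ * X]big1 ?mulr0 // => k _;
  apply: big1 => k' _.
    by rewrite /permute_indices /tensor_product /= vT // mul0r mulr0.
  by rewrite /permute_indices /tensor_product /= vS // !mulr0.
- move=> g x h A B psi gx a b; rewrite (diagonal_contract _ _ gx).
  under eq_bigr do rewrite (diagonal_contract _ _ gx).
  rewrite /permute_indices /tensor_product /=.
  pose K : 'I_D -> 'I_D -> R := sectional (p A B psi) (q A B psi) (s A B psi).
  pose X u := pick_block u (p' A B psi) (q' A B psi).
  have h0 : forall i, h i != 0 by case: gx.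
  rewrite (eq_bigr (fun u => h a * (K u a * pair_sign u a u b * X u))).
    rewrite -mulr_sumr /K sectional_pair ?sectional_diag // sectional_row.
    by ring.
  move=> u _.
  rewrite (eq_bigr (fun k => (u == k)%:R * (h a * h u * (K k a * pair_sign k a u b * X k)))).
    by rewrite sum_delta; have := h0 u => hu; field.
  move=> k _; rewrite (pT _ _ _ _ _ _ gx) (pS _ _ _ _ _ _ gx) -/(K k a) -/(X k) (eq_sym k u).
  have := h0 k => hk; have [->|_] := eqVneq u k; first by field.
  by rewrite (_ : false%:R = 0 :> R) //; ring.
Qed.

Lemma sectional_curv_ext v n p q s p' q' s' : sectional_curv v n p q s ->
  (forall A B psi, p A B psi = p' A B psi) ->
  (forall A B psi, q A B psi = q' A B psi) ->
  (forall A B psi, s A B psi = s' A B psi) -> sectional_curv v n p' q' s'.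
Proof.
move=> [T [cT vT pT]] pp qq ss; exists T; split => // g x h A B psi gx a b c e.
by rewrite (pT _ _ _ _ _ _ gx) pp qq ss.
Qed.

Lemma sectional_curv_add v n p q s p' q' s' :
  sectional_curv v n p q s -> sectional_curv v n p' q' s' ->
  sectional_curv v n (fun A B psi => p A B psi + p' A B psi)
    (fun A B psi => q A B psi + q' A B psi) (fun A B psi => s A B psi + s' A B psi).
Proof.
move=> [T [cT vT pT]] [S [cS vS pS]]; exists (fun g l x => T g l x + S g l x).
split; first exact: ct_add.
- by move=> /[dup] /vT {}vT /vS {}vS g x fl a b c e; rewrite vT // vS // addr0.
- move=> g x h A B psi gx a b c e; rewrite (pT _ _ _ _ _ _ gx) (pS _ _ _ _ _ _ gx) /sectional.
  by do ![case: ifP => _]; ring.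
Qed.

Lemma sectional_curv_riemann : sectional_curv false 1
  (fun A B psi => A) (fun A B psi => B) (fun A B psi => psi).
Proof.
exists (@riemann_tensor R d); split => //; first exact: ct_riemann.
by move=> g x h A B psi [_ _ rE] a b c e; rewrite /= rE.
Qed.

(** The four-term product of T with the metric has, on the plane of [a] and [b], the sum of the two
    eigenvalues of T as sectional curvature. *)
Lemma sectional_curv_kulkarni_nomizu v n p q : diagonal_curv v n p q ->
  sectional_curv v n (fun A B psi => p A B psi + p A B psi)
    (fun A B psi => p A B psi + q A B psi) (fun A B psi => q A B psi + q A B psi).
Proof.
move=> [T [cT vT pT]]; pose P := tensor_product 2 T (@metric_tensor R d).
have cP : curvature n.*2 4 P.
  by have := ct_product cT (@ct_metric R d false); rewrite addn0.
have cQ l : perm_eq l (iota 0 4) -> curvature n.*2 4 (permute_indices l P).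
  by move=> pl; exact: ct_permute pl cP.
pose Q l := permute_indices l P.
exists (fun g l x => (Q [:: 0; 2; 1; 3] g l x + Q [:: 1; 3; 0; 2] g l x)
  + (-1) * (Q [:: 0; 3; 1; 2] g l x + Q [:: 1; 2; 0; 3] g l x)).
split.
- by apply: ct_add; [|apply: ct_scale]; apply: ct_add; exact: cQ.
- move=> /vT {}vT g x fl a b c e.
  by rewrite /Q /permute_indices /P /tensor_product /= !vT // !mul0r !addr0 mulr0 addr0.
- move=> g x h A B psi gx a b c e.
  rewrite /Q /permute_indices /P /tensor_product /= !(pT _ _ _ _ _ _ gx).
  have gE i j : g x i j = (i == j)%:R * h i.
    by case: gx => -> _ _; rewrite !mxE mulr_natl.
  rewrite /sectional !gE /pick_block pair_signE.
  have [->|ab] := eqVneq a b; first by ring.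
  by do ![case: ifP => _]; ring.
Qed.

(** This is composition of curvature operators on 2-forms, all diagonalised by the coordinate
    planes. The factor 1/2 compensates for summing over ordered pairs of indices, which counts each
    plane twice. *)
Lemma sectional_curv_mul v w n m p q s p' q' s' :
  sectional_curv v n p q s -> sectional_curv w m p' q' s' ->
  sectional_curv (v || w) (n + m) (fun A B psi => p A B psi * p' A B psi)
    (fun A B psi => q A B psi * q' A B psi) (fun A B psi => s A B psi * s' A B psi).
Proof.
move=> [T [cT vT pT]] [S [cS vS pS]].
exists (fun g l x => 2^-1 * contract_indices (contract_indices
  (permute_indices [:: 4; 5; 0; 2; 1; 3; 6; 7] (tensor_product 4 T S))) g l x).
split.
- rewrite doubleD; apply: ct_scale; do 2 apply: ct_contraction; apply: ct_permute => //.
  exact: ct_product cT cS.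
- move=> /orP[/vT {}vT|/vS {}vS] g x fl a b c e; rewrite [X in _ * X]big1 ?mulr0 // => u _;
  apply: big1 => u' _; rewrite [X in _ * X]big1 ?mulr0 // => k _;
  apply: big1 => k' _.
    by rewrite /permute_indices /tensor_product /= vT // mul0r mulr0.
  by rewrite /permute_indices /tensor_product /= vS // !mulr0.
- move=> g x h A B psi gx a b c e; rewrite (diagonal_contract _ _ gx).
  under eq_bigr do rewrite (diagonal_contract _ _ gx).
  rewrite /permute_indices /tensor_product /=.
  pose K := sectional (p A B psi) (q A B psi) (s A B psi) a b.
  pose L : 'I_D -> 'I_D -> R := sectional (p' A B psi) (q' A B psi) (s' A B psi).
  have h0 : forall i, h i != 0 by case: gx.
  have LS : forall i j, L i j = L j i by move=> i j; exact: sectional_sym.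
  rewrite (eq_bigr (fun u => h a * h b * K *
    ((b == u)%:R * (L a u * pair_sign a u c e) - (a == u)%:R * (L b u * pair_sign b u c e)))).
    rewrite -mulr_sumr big_split /= sumrN !sum_delta (LS b a).
    have -> : pair_sign b a c e = - pair_sign a b c e :> R.
      by rewrite /pair_sign opprB andbC (andbC (b == e)).
    by rewrite /K /L /sectional; do ![case: ifP => _]; field.
  move=> u _.
  rewrite (eq_bigr (fun k => (h u) * (h a * h b * K *
     ((a == k)%:R * ((b == u)%:R * (L k u * pair_sign k u c e))
     - (b == k)%:R * ((a == u)%:R * (L k u * pair_sign k u c e)))))).
    rewrite -!mulr_sumr big_split /= sumrN !sum_delta; have := h0 u => hu; field.
    by rewrite hu.
  move=> k _; rewrite (pT _ _ _ _ _ _ gx) (pS _ _ _ _ _ _ gx) -/K -/(L k u) pair_signE.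
  by have hk := h0 k; field.
Qed.

End DiagonalTensors.

(** * Weyl parts of curvature invariants *)

Section WeylContractions.
Context {R : realType} {d : nat}.
Local Notation D := d.+2.
Local Notation point := 'rV[R]_D.
Local Notation curvature := (curvature_tensor (R := R) (d := d) false).

(* A component of a tensor built from a diagonal metric h vanishes unless every
   index occurs an even number m_i of times, and then it is a constant times
   prod_i h_i^(m_i / 2).  Halving the multiplicities avoids square roots of the
   h_i, whose signs vary. *)
Definition index_weight (h : 'I_D -> R) (s : seq 'I_D) : R :=
  \prod_i h i ^+ (count_mem i s)./2.

Definition even_indices (s : seq 'I_D) : Prop := forall i, ~~ odd (count_mem i s).

Lemma index_weight_nil h : index_weight h [::] = 1.
Proof. by rewrite /index_weight big1. Qed.

Lemma index_weight_pair h a s :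
  index_weight h [:: a, a & s] = h a * index_weight h s.
Proof.
rewrite /index_weight (bigD1 a) //= [in RHS](bigD1 a) //= eqxx mulrA; congr (_ * _).
  by rewrite addnA /= exprS.
by apply: eq_bigr => i ia; rewrite eq_sym (negbTE ia).
Qed.

Lemma index_weight_perm h s s' : perm_eq s s' ->
  index_weight h s = index_weight h s'.
Proof. by move=> /seq.permP pss; apply: eq_bigr => i _; rewrite pss. Qed.

Lemma index_weight_cat h s s' : even_indices s ->
  index_weight h (s ++ s') = index_weight h s * index_weight h s'.
Proof.
move=> es; rewrite /index_weight -big_split /=; apply: eq_bigr => i _.
by rewrite count_cat halfD (negbTE (es i)) add0n exprD.
Qed.

(* [t s w] is the constant in front of [index_weight h s], as a function of the
   sectional curvatures [w]. *)
Definition contraction_scheme (r n : nat)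
    (t : seq 'I_D -> ('I_D -> 'I_D -> R) -> R) : Prop :=
  [/\ forall s w, size s = r -> t s w != 0 -> even_indices s,
      forall s w c, size s = r -> t s (fun a b => c * w a b) = c ^+ n * t s w,
      forall (f : 'I_D -> 'I_D) s w, injective f -> size s = r ->
        t (map f s) w = t s (fun a b => w (f a) (f b)) &
      n = 1%N -> forall s w w', size s = r ->
        t s (fun a b => w a b + w' a b) = t s w + t s w'].

(** Homogeneity of degree 0 with the factor 0, where [0 ^+ 0 = 1], identifies every value with the
    one at the zero array. *)
Lemma contraction_scheme_const r t s w w' :
  contraction_scheme r 0 t -> size s = r -> t s w = t s w'.
Proof.
move=> [_ th _ _] sr; have := th s w 0 sr; have := th s w' 0 sr.
rewrite expr0 !mul1r => <- <-; congr (t s _).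
by apply/funext => a; apply/funext => b; rewrite !mul0r.
Qed.

Variables p q s0 : R -> R -> R -> R.
Hypothesis correction : @sectional_curv R d true 1 p q s0.

Definition weyl_part (A B psi : R) : 'I_D -> 'I_D -> R :=
  sectional (A + p A B psi) (B + q A B psi) (psi + s0 A B psi).

(* [T'] is [T] with the Riemann tensor replaced by its sum with the correction. *)
Definition weyl_form (k r : nat) (T : @tensor R d) : Prop :=
  exists n T' t, [/\ k = n.*2, curvature k r T',
    forall g x, ricci_flat_at g x -> forall s, size s = r -> T' g s x = T g s x,
    forall g x h A B psi, diagonal_point g x h (sectional A B psi) ->
      forall s, size s = r ->
        T' g s x = index_weight h s * t s (weyl_part A B psi) &
    contraction_scheme r n t].

Lemma weyl_form_metric : weyl_form 0 2 (@metric_tensor R d).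
Proof.
pose t (s : seq 'I_D) (w : 'I_D -> 'I_D -> R) : R :=
  if s is [:: a; b] then (a == b)%:R else 0.
exists 0%N, (@metric_tensor R d), t; split => //.
- exact: ct_metric.
- move=> g x h A B psi [gE _ _] [|a [|b [|c s]]] //= _.
  rewrite gE !mxE; case: eqP => [->|_]; last by rewrite mulr0.
  by rewrite index_weight_pair index_weight_nil !mulr1.
split => //.
- move=> [|a [|b [|c s]]] //= w _; case: (eqVneq a b) => [->|]; last by rewrite eqxx.
  by move=> _ i /=; case: eqP.
- by move=> s w c _; rewrite expr0 mul1r.
- by move=> f [|a [|b [|c s]]] //= w fi _; rewrite inj_eq.
Qed.

Lemma weyl_form_riemann : weyl_form 2 4 (@riemann_tensor R d).
Proof.
have [C [cC vC pC]] := correction.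
pose t (s : seq 'I_D) (w : 'I_D -> 'I_D -> R) : R :=
  if s is [:: a; b; c; e] then w a b * pair_sign a b c e else 0.
exists 1%N, (fun g s x => riemann_tensor g s x + C g s x), t; split => //.
- by apply: ct_add => //; exact: ct_riemann.
- by move=> g x fl [|a [|b [|c [|e [|i s]]]]] // _; rewrite vC // addr0.
- move=> g x h A B psi gx [|a [|b [|c [|e [|i s]]]]] // _.
  rewrite (pC _ _ _ _ _ _ gx); case: gx => _ _ rE; rewrite [riemann_tensor _ _ _]rE /t.
  apply: (@eq_trans _ _ (h a * h b * weyl_part A B psi a b * pair_sign a b c e)).
    by rewrite /weyl_part /sectional; do ![case: ifP => _]; ring.
  have [->|ab] := eqVneq a b.
    by rewrite /weyl_part sectional_diag; ring.
  (* Wherever [pair_sign] can be nonzero the four indices are a permutation of a, a, b, b. *)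
  have wE : (a == c) && (b == e) || (a == e) && (b == c) ->
      index_weight h [:: a; b; c; e] = h a * h b.
    have <- : index_weight h [:: a; a; b; b] = h a * h b.
      by rewrite !index_weight_pair index_weight_nil mulr1.
    case/orP=> /andP[/eqP <- /eqP <-]; apply: index_weight_perm.
      by rewrite perm_cons -(perm_catCA [:: a] [:: b] [:: b]).
    by rewrite perm_cons (perm_catC [:: b; b] [:: a]).
  rewrite /pair_sign; case: (boolP (_ || _)) wE => [_ ->//|].
    by rewrite mulrA.
  by rewrite negb_or => /andP[/negbTE -> /negbTE ->] _; rewrite subrr !mulr0.
split.
- move=> [|a [|b [|c [|e [|i s]]]]] // w _ /=.
  rewrite /pair_sign; case: (boolP (_ && _)) => [/andP[/eqP <- /eqP <-] _ i /=|_].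
    by do 2 case: eqP.
  case: (boolP (_ && _)) => [/andP[/eqP <- /eqP <-] _ i /=|_].
    by do 2 case: eqP.
  by rewrite subrr mulr0 eqxx.
- by move=> [|a [|b [|c [|e [|i s]]]]] // w k _ /=; rewrite expr1 mulrA.
- move=> f [|a [|b [|c [|e [|i s]]]]] // w fi _ /=.
  by rewrite /pair_sign !(inj_eq fi).
- by move=> _ [|a [|b [|c [|e [|i s]]]]] // w w' _ /=; rewrite mulrDl.
Qed.

Lemma weyl_form_product k l r r' T S : weyl_form k r T -> weyl_form l r' S ->
  weyl_form (k + l) (r + r') (tensor_product r T S).
Proof.
move=> [n [T' [t [kn cT fT dT sT]]]] [m [S' [u [lm cS fS dS sS]]]].
have tk (s : seq 'I_D) : size s = (r + r')%N -> size (take r s) = r.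
  by move=> ss; rewrite size_take ss; case: ltngtP (leq_addr r' r) => //; rewrite leqNgt => ->.
have dk (s : seq 'I_D) : size s = (r + r')%N -> size (drop r s) = r'.
  by move=> ss; rewrite size_drop ss addKn.
exists (n + m)%N, (tensor_product r T' S'), (fun s w => t (take r s) w * u (drop r s) w).
split.
- by rewrite kn lm doubleD.
- exact: ct_product.
- by move=> g x fl s ss; rewrite /tensor_product fT ?fS ?tk ?dk.
- move=> g x h A B psi gx s ss; rewrite /tensor_product (dT _ _ _ _ _ _ gx) ?tk //.
  rewrite (dS _ _ _ _ _ _ gx) ?dk //.
  (* Weights multiply when the multiplicities in the first list are even, as halving is not additive
     in general. Either the first factor vanishes, or the parity clause applies to it. *)
  have [t0|t0] := eqVneq (t (take r s) (weyl_part A B psi)) 0.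
    by rewrite t0 !(mulr0, mul0r).
  have ev := let: And4 e _ _ _ := sT in e _ _ (tk s ss) t0.
  rewrite -[in RHS](cat_take_drop r s) index_weight_cat // cat_take_drop.
  by ring.
case: (sT) => t1 t2 t3 t4; case: (sS) => u1 u2 u3 u4; split.
- move=> s w ss; rewrite mulf_eq0 negb_or => /andP[/t1 ht /u1 hu] i.
  rewrite -(cat_take_drop r s) count_cat oddD.
  by rewrite (negbTE (ht (tk _ ss) i)) (negbTE (hu (dk _ ss) i)).
- by move=> s w c ss; rewrite t2 ?u2 ?tk ?dk // exprD; ring.
- by move=> f s w fi ss; rewrite -map_take -map_drop t3 ?u3 ?tk ?dk.
(* In total degree 1 one factor has degree 0, hence does not depend on the array, and the other is
   additive. *)
- move=> nm s w w' ss; have [st sd] := (tk _ ss, dk _ ss).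
  case: n m nm sT sS t4 u4 {kn lm t2 u2} => [|[|n]] [|[|m]] //= _ sT sS t4 u4.
    rewrite (contraction_scheme_const w' w sT st) u4 // mulrDr.
    by rewrite !(contraction_scheme_const _ w sT st).
  rewrite (contraction_scheme_const w' w sS sd) t4 // mulrDl.
  by rewrite !(contraction_scheme_const _ w sS sd).
Qed.

(** A repeated index [a] contributes [h a] to the weight, which the inverse metric cancels; it keeps
    all parities. *)
Lemma weyl_form_contraction k r T : weyl_form k r.+2 T ->
  weyl_form k r (contract_indices T).
Proof.
move=> [n [T' [t [kn cT fT dT [t1 t2 t3 t4]]]]].
exists n, (contract_indices T'), (fun s w => \sum_a t [:: a, a & s] w); split => //.
- exact: ct_contraction.
- move=> g x fl s ss; apply: eq_bigr => a _; apply: eq_bigr => b _.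
  by rewrite fT //= ss.
- move=> g x h A B psi gx s ss; rewrite (diagonal_contract _ _ gx) mulr_sumr.
  apply: eq_bigr => a _; rewrite (dT _ _ _ _ _ _ gx) /= ?ss // index_weight_pair.
  by case: gx => _ h0 _; rewrite !mulrA mulVf // mul1r.
split.
- move=> s w ss t0.
  have [a ta] : exists a, t [:: a, a & s] w != 0.
    apply/existsP; apply: contraNT t0; rewrite negb_exists => /forallP t0.
    by rewrite big1 // => a _; apply/eqP; have := t0 a; rewrite negbK.
  have := t1 _ _ _ ta => /= /(_ (congr1 (addn 2) ss)) ev i.
  by have := ev i; rewrite /= addnA addnn oddD odd_double.
- move=> s w c ss; rewrite mulr_sumr; apply: eq_bigr => a _.
  by rewrite t2 //= ss.
- move=> f s w fi ss; rewrite (reindex_inj fi) /=; apply: eq_bigr => a _.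
  by rewrite -(t3 f [:: a, a & s]) //= ss.
- move=> n1 s w w' ss; rewrite -big_split /=; apply: eq_bigr => a _.
  by rewrite t4 //= ss.
Qed.

Lemma map_nth_perm (l : seq nat) (s : seq 'I_D) :
  perm_eq l (iota 0 (size s)) -> perm_eq [seq nth 0 s j | j <- l] s.
Proof.
move=> pl; have := perm_map (fun j => nth 0 s j) pl.
by rewrite -[X in perm_eq _ X -> _]/(mkseq _ _) mkseq_nth.
Qed.

Lemma weyl_form_permute k r l T : perm_eq l (iota 0 r) -> weyl_form k r T ->
  weyl_form k r (permute_indices l T).
Proof.
move=> pl [n [T' [t [kn cT fT dT [t1 t2 t3 t4]]]]].
pose m (s : seq 'I_D) := [seq nth 0 s j | j <- l].
have sm s : size (m s) = r by rewrite size_map (perm_size pl) size_iota.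
have pm s : size s = r -> perm_eq (m s) s.
  by move=> ss; apply: map_nth_perm; rewrite ss.
exists n, (permute_indices l T'), (fun s w => t (m s) w); split => //.
- exact: ct_permute.
- by move=> g x fl s ss; exact: fT (sm s).
- move=> g x h A B psi gx s ss; rewrite -(index_weight_perm h (pm s ss)).
  exact: dT gx _ (sm s).
split.
- by move=> s w ss t0 i; have := t1 _ _ (sm s) t0 i; rewrite (seq.permP (pm s ss)).
- by move=> s w c ss; rewrite t2.
- move=> f s w fi ss; rewrite -(t3 f (m s) w) //; congr (t _ w).
  rewrite /m -map_comp; apply/eq_in_map => j.
  rewrite (perm_mem pl) mem_iota add0n /= => jr.
  by rewrite (nth_map 0) // ss.
- by move=> n1 s w w' ss; rewrite t4.
Qed.

Lemma weyl_form_add k r T S : weyl_form k r T -> weyl_form k r S ->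
  weyl_form k r (fun g s x => T g s x + S g s x).
Proof.
move=> [n [T' [t [kn cT fT dT [t1 t2 t3 t4]]]]] [m [S' [u [km cS fS dS [u1 u2 u3 u4]]]]].
have nm : m = n by apply: double_inj; rewrite -kn -km.
subst m; exists n, (fun g s x => T' g s x + S' g s x), (fun s w => t s w + u s w).
split => //.
- exact: ct_add.
- by move=> g x fl s ss; rewrite fT ?fS.
- by move=> g x h A B psi gx s ss; rewrite (dT _ _ _ _ _ _ gx) // (dS _ _ _ _ _ _ gx) // mulrDr.
split.
- move=> s w ss; have [/t1 ht _|] := boolP (t s w != 0); first exact: ht.
  by rewrite negbK => /eqP ->; rewrite add0r => /u1; exact.
- by move=> s w c ss; rewrite t2 // u2 // mulrDr.
- by move=> f s w fi ss; rewrite t3 ?u3.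
- by move=> n1 s w w' ss; rewrite t4 ?u4 //; ring.
Qed.

Lemma weyl_form_scale k r c T : weyl_form k r T ->
  weyl_form k r (fun g s x => c * T g s x).
Proof.
move=> [n [T' [t [kn cT fT dT [t1 t2 t3 t4]]]]].
exists n, (fun g s x => c * T' g s x), (fun s w => c * t s w); split => //.
- exact: ct_scale.
- by move=> g x fl s ss; rewrite fT.
- by move=> g x h A B psi gx s ss; rewrite (dT _ _ _ _ _ _ gx) // mulrCA.
split.
- by move=> s w ss; rewrite mulf_eq0 negb_or => /andP[_ /t1]; exact.
- by move=> s w k' ss; rewrite t2 // mulrCA.
- by move=> f s w fi ss; rewrite t3.
- by move=> n1 s w w' ss; rewrite t4 // mulrDr.
Qed.

Lemma curvature_weyl_form k r T : curvature k r T -> weyl_form k r T.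
Proof.
elim=> {k r T} //.
- exact: weyl_form_metric.
- exact: weyl_form_riemann.
- by move=> *; exact: weyl_form_product.
- by move=> *; exact: weyl_form_contraction.
- by move=> *; exact: weyl_form_permute.
- by move=> *; exact: weyl_form_add.
- by move=> *; exact: weyl_form_scale.
Qed.

End WeylContractions.

(** * Linear invariants of trace-free arrays *)

Section TraceFree.
Context {R : realType} {d : nat}.
Local Notation D := d.+2.

(* A linear invariant of a symmetric array is a multiple of its trace: average
   the array over all permutations of the indices. *)
Lemma contraction_scheme_tracefree t (w : 'I_D -> 'I_D -> R) :
  contraction_scheme 0 1 t -> (forall a, w a a = 0) -> \sum_a \sum_b w a b = 0 ->
  t [::] w = 0.
Proof.
move=> [_ th te ta] w0 wtr.
pose W (f : {perm 'I_D}) a b := w (f a) (f b).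
have tW (f : {perm 'I_D}) : t [::] (W f) = t [::] w.
  by rewrite /W -(te f [::] w (@perm_inj _ f)).
pose V a b := \sum_(f : {perm 'I_D}) W f a b.
have V_diag a : V a a = 0 by apply: big1 => f _; exact: w0.
have V_perm (u : {perm 'I_D}) a b : V (u a) (u b) = V a b.
  rewrite /V (reindex_inj (mulgI (u^-1)%g)) /=; apply: eq_bigr => f _.
  by rewrite /W !permM !permK.
(* The symmetric group is 2-transitive: two transpositions carry (a, b) to (a', b'). *)
have V_off a b a' b' : a != b -> a' != b' -> V a' b' = V a b.
  move=> ab ab'; pose u := tperm a a'; pose u' := tperm (u b) b'.
  rewrite -(V_perm u a b) -(V_perm u' (u a) (u b)) /u' tpermL /u tpermL.
  by rewrite tpermD // ?(eq_sym b') // -{2}(tpermL a a') (inj_eq perm_inj) eq_sym.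
have V_tr : \sum_a \sum_b V a b = 0.
  rewrite /V; under eq_bigr do rewrite exchange_big /=.
  rewrite exchange_big /= big1 // => f _; rewrite -[RHS]wtr.
  rewrite [RHS](reindex_inj (@perm_inj _ f)) /=; apply: eq_bigr => a _.
  by rewrite [RHS](reindex_inj (@perm_inj _ f)).
have V0 : V 0 1 = 0.
  have E a : \sum_b V a b = d.+1%:R * V 0 1.
    rewrite (bigD1 a) //= V_diag add0r (eq_bigr (fun=> V 0 1)); last first.
      by move=> b ba; apply: V_off => //; rewrite eq_sym.
    by rewrite sumr_const cardC1 card_ord mulr_natl.
  move: V_tr; under eq_bigr do rewrite E.
  by rewrite sumr_const card_ord => /eqP; rewrite mulrn_eq0 mulf_eq0 pnatr_eq0 => /eqP.
have {}V0 a b : V a b = 0.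
  by have [->|ab] := eqVneq a b; [exact: V_diag|rewrite (V_off 0 1)].
have t0 : t [::] (fun _ _ => 0) = 0.
  have E := th [::] w 0 erefl; rewrite expr1 mul0r in E; rewrite -[RHS]E.
  by congr (t _ _); apply/funext => a; apply/funext => b; rewrite mul0r.
have Vsum (l : seq {perm 'I_D}) :
    t [::] (fun a b => \sum_(f <- l) W f a b) = \sum_(f <- l) t [::] (W f).
  elim: l => [|f l IH].
    rewrite big_nil -[RHS]t0; congr (t _ _).
    by apply/funext => a; apply/funext => b; rewrite big_nil.
  rewrite big_cons -IH -ta //; congr (t _ _).
  by apply/funext => a; apply/funext => b; rewrite big_cons.
(* The sum over all permutations is the zero array, and every summand has the same value under [t];
   so this value times the order of the group is 0. *)
have := Vsum (index_enum {perm 'I_D}); under [RHS]eq_bigr do rewrite tW.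
have -> : t [::] (fun a b => \sum_f W f a b) = 0.
  rewrite -[RHS]t0; congr (t _ _).
  by apply/funext => a; apply/funext => b; rewrite -[LHS]/(V a b) V0.
move/esym/eqP; rewrite sumr_const mulrn_eq0.
case/orP => [|/eqP //]; rewrite -leqn0 leqNgt => /negP[].
by apply/card_gt0P; exists 1%g.
Qed.

End TraceFree.

(** * Monomials in the scalar, traceless Ricci and Weyl curvatures *)

Section Generators.
Context {R : realType} {d : nat}.
Local Notation D := d.+2.
Local Notation scalar_curv := (@scalar_curv R d).
Local Notation diagonal_curv := (@diagonal_curv R d).
Local Notation sectional_curv := (@sectional_curv R d).
Local Notation dR := (d%:R : R).

(* At a point with sectional curvatures [A], [B], [psi] the Ricci scalar is
   (d+1)(d+2) [rho], the traceless Ricci tensor is [d * zeta] on the (t, r)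
   plane and [- 2 * zeta] on the sphere, and the Weyl tensor has sectional
   curvatures d(d-1)/2 [phi], -(d-1)/2 [phi] and [phi]. *)
Definition zeta (A B psi : R) : R :=
  (A + (dR - 2) * B - (dR - 1) * psi) / (dR + 2).
Definition rho (A B psi : R) : R :=
  (2 * (A + dR * B) + dR * (2 * B + (dR - 1) * psi)) / ((dR + 1) * (dR + 2)).
Definition phi (A B psi : R) : R :=
  2 * (A - 2 * B + psi) / (dR * (dR + 1)).

Lemma dim1_neq0 : dR + 1 != 0.
Proof. by rewrite natr1 pnatr_eq0. Qed.

Lemma dim2_neq0 : dR + 2 != 0.
Proof. by rewrite -natrD pnatr_eq0 addn2. Qed.

Lemma scalar_curv_divide v n p c : c != 0 ->
  scalar_curv v n (fun A B psi => c * p A B psi) -> scalar_curv v n p.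
Proof.
move=> c0 /(scalar_curv_scale c^-1) H; apply: scalar_curv_ext H _ => A B psi.
by rewrite mulKf.
Qed.

(** Tensors of order 0 arise only from the metric, so constants come from its trace, the
    dimension. *)
Lemma scalar_curv_one : scalar_curv false 0 (fun _ _ _ => 1).
Proof.
have := diagonal_curv_trace (@diagonal_curv_metric R d) => H.
apply: (@scalar_curv_divide _ _ _ (dR + 2)); first exact: dim2_neq0.
by apply: scalar_curv_ext H _ => A B psi; ring.
Qed.

Lemma scalar_curv_ricci : scalar_curv true 1
  (fun A B psi => 2 * (A + dR * B) + dR * (2 * B + (dR - 1) * psi)).
Proof. exact: diagonal_curv_trace diagonal_curv_ricci. Qed.

Lemma scalar_curv_rho : scalar_curv true 1 rho.
Proof.
apply: (@scalar_curv_divide _ _ _ ((dR + 1) * (dR + 2))).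
  by rewrite mulf_neq0 ?dim2_neq0 ?dim1_neq0.
apply: scalar_curv_ext scalar_curv_ricci _ => A B psi; rewrite /rho.
by field; rewrite ?dim2_neq0 ?dim1_neq0.
Qed.

Lemma diagonal_curv_zeta : diagonal_curv true 1
  (fun A B psi => dR * zeta A B psi) (fun A B psi => - 2 * zeta A B psi).
Proof.
have H := diagonal_curv_add (@diagonal_curv_ricci R d)
  (diagonal_curv_scale (- (dR + 2)^-1)
    (diagonal_curv_scalar scalar_curv_ricci (@diagonal_curv_metric R d))).
apply: diagonal_curv_ext H _ _ => A B psi; rewrite /zeta;
  by field; rewrite ?dim2_neq0 ?dim1_neq0.
Qed.

(** This is the Kulkarni-Nomizu product of the metric with a combination of the Ricci tensor and the
    Ricci scalar times the metric. *)
Lemma ricci_correction (a b : R) :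
  sectional_curv true 1
   (fun A B psi => 2 * (a * (A + dR * B)
      + b * (2 * (A + dR * B) + dR * (2 * B + (dR - 1) * psi))))
   (fun A B psi => a * (A + dR * B + (2 * B + (dR - 1) * psi))
      + 2 * (b * (2 * (A + dR * B) + dR * (2 * B + (dR - 1) * psi))))
   (fun A B psi => 2 * (a * (2 * B + (dR - 1) * psi)
      + b * (2 * (A + dR * B) + dR * (2 * B + (dR - 1) * psi)))).
Proof.
have H := sectional_curv_kulkarni_nomizu (diagonal_curv_add
  (diagonal_curv_scale a (@diagonal_curv_ricci R d))
  (diagonal_curv_scale b
    (diagonal_curv_scalar scalar_curv_ricci (@diagonal_curv_metric R d)))).
by apply: sectional_curv_ext H _ _ _ => A B psi; ring.
Qed.

Hypothesis d_gt0 : (0 < d)%N.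

Lemma dimR_neq0 : dR != 0.
Proof. by rewrite pnatr_eq0 -lt0n. Qed.

Lemma weyl_correction : exists p q s,
  [/\ sectional_curv true 1 p q s,
   forall A B psi, A + p A B psi = dR * (dR - 1) / 2 * phi A B psi,
   forall A B psi, B + q A B psi = - (dR - 1) / 2 * phi A B psi &
   forall A B psi, psi + s A B psi = phi A B psi].
Proof.
have [h0 h1] := (dimR_neq0, dim1_neq0).
do 3 eexists; split; first exact: (ricci_correction (- dR^-1) ((2 * dR * (dR + 1))^-1));
  by move=> A B psi; rewrite /phi; field; rewrite ?h0 ?h1.
Qed.

Lemma sectional_curv_weyl : sectional_curv false 1
  (fun A B psi => dR * (dR - 1) / 2 * phi A B psi)
  (fun A B psi => - (dR - 1) / 2 * phi A B psi) phi.
Proof.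
have [p [q [s [[C [cC _ pC]] pE qE sE]]]] := weyl_correction.
have C' : sectional_curv false 1 p q s by exists C; split.
by apply: sectional_curv_ext (sectional_curv_add (@sectional_curv_riemann R d) C') _ _ _.
Qed.

Local Notation Z := diagonal_curv_zeta.
Local Notation W := sectional_curv_weyl.
Local Notation g := (@diagonal_curv_metric R d).
(** Ricci contractions of the square and the cube of the Weyl tensor as an operator on 2-forms.
    Unlike the contraction of the Weyl tensor itself they need not vanish. *)
Local Notation W2 := (diagonal_curv_apply (sectional_curv_mul W W) g).
Local Notation W3 := (diagonal_curv_apply (sectional_curv_mul W (sectional_curv_mul W W)) g).

Lemma scalar_curv_zeta2 : scalar_curv true 2 (fun A B psi => zeta A B psi ^+ 2).
Proof.
apply: (@scalar_curv_divide _ _ _ (2 * dR * (dR + 2))).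
  by rewrite !mulf_neq0 ?dim2_neq0 ?dim1_neq0 ?dimR_neq0 // pnatr_eq0.
by apply: scalar_curv_ext (diagonal_curv_trace (diagonal_curv_mul Z Z)) _ => A B psi; ring.
Qed.

Hypothesis d_gt1 : (1 < d)%N.

Lemma dim_gt1 : exists2 e : R, 0 <= e & dR = e + 2.
Proof. by exists (d - 2)%N%:R => //; rewrite -natrD subnK. Qed.

Lemma dimB1_neq0 : dR - 1 != 0.
Proof. by have [e e0 ->] := dim_gt1; rewrite gt_eqF //; lra. Qed.

Lemma scalar_curv_zeta2phi :
  scalar_curv true 3 (fun A B psi => zeta A B psi ^+ 2 * phi A B psi).
Proof.
apply: (@scalar_curv_divide _ _ _ (dR * (dR - 1) * (dR + 2) ^+ 2)).
  by rewrite !mulf_neq0 ?expf_neq0 ?dim2_neq0 ?dim1_neq0 ?dimR_neq0 ?dimB1_neq0.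
apply: scalar_curv_ext (diagonal_curv_trace (diagonal_curv_mul Z (diagonal_curv_apply W Z))) _.
by move=> A B psi; field.
Qed.

Lemma scalar_curv_phi2 : scalar_curv false 2 (fun A B psi => phi A B psi ^+ 2).
Proof.
apply: (@scalar_curv_divide _ _ _ (dR * (dR - 1) * (dR * (dR - 1) / 2 + (dR - 1) + 1))).
  have [e e0 dE] := dim_gt1.
  rewrite !mulf_neq0 ?dimR_neq0 ?dimB1_neq0 // dE gt_eqF //.
  have := mulr_ge0 e0 e0; nra.
apply: scalar_curv_ext (diagonal_curv_trace W2) _.
by move=> A B psi; field.
Qed.

Lemma scalar_curv_phi3 : scalar_curv false 3 (fun A B psi => phi A B psi ^+ 3).
Proof.
apply: (@scalar_curv_divide _ _ _
  (dR * (dR - 1) * ((dR - 1) ^+ 2 * (dR ^+ 2 - 2) / 4 + 1))).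
  have [e e0 dE] := dim_gt1.
  rewrite !mulf_neq0 ?dimR_neq0 ?dimB1_neq0 // dE gt_eqF //.
  apply: ltr_pwDr => //; apply: mulr_ge0 => //; apply: mulr_ge0; first exact: sqr_ge0.
  by have := mulr_ge0 e0 e0; nra.
apply: scalar_curv_ext (diagonal_curv_trace W3) _.
by move=> A B psi; field.
Qed.

(** The exponents 2 and 3 generate all exponents other than 1. *)
Lemma scalar_curv_phi l : l != 1%N ->
  scalar_curv false l (fun A B psi => phi A B psi ^+ l).
Proof.
have [n] := ubnP l; elim: n l => // n IH [|[|[|[|l]]]] // ln _.
- exact: scalar_curv_one.
- exact: scalar_curv_phi2.
- exact: scalar_curv_phi3.
have H := scalar_curv_mul scalar_curv_phi2 (IH l.+2 ltac:(by rewrite -ltnS (ltn_trans _ ln)) erefl).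
by apply: scalar_curv_ext H _ => A B psi; rewrite -exprD.
Qed.

Lemma dimB2_neq0 : (2 < d)%N -> dR - 2 != 0.
Proof. by move=> d2; rewrite subr_eq0 eqr_nat gtn_eqF. Qed.

Lemma scalar_curv_zeta3 : (2 < d)%N ->
  scalar_curv true 3 (fun A B psi => zeta A B psi ^+ 3).
Proof.
move=> d2; apply: (@scalar_curv_divide _ _ _ (2 * dR * (dR - 2) * (dR + 2))).
  by rewrite !mulf_neq0 ?dim2_neq0 ?dim1_neq0 ?dimR_neq0 ?dimB2_neq0 // pnatr_eq0.
apply: scalar_curv_ext (diagonal_curv_trace (diagonal_curv_mul Z (diagonal_curv_mul Z Z))) _.
by move=> A B psi; ring.
Qed.

Lemma scalar_curv_zeta3phi : (2 < d)%N ->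
  scalar_curv true 4 (fun A B psi => zeta A B psi ^+ 3 * phi A B psi).
Proof.
move=> d2; apply: (@scalar_curv_divide _ _ _
  (dR * (dR - 1) * (dR - 2) * (dR + 2) ^+ 2)).
  by rewrite !mulf_neq0 ?expf_neq0 ?dim2_neq0 ?dim1_neq0 ?dimR_neq0 ?dimB1_neq0 ?dimB2_neq0.
apply: scalar_curv_ext (diagonal_curv_trace
  (diagonal_curv_mul (diagonal_curv_mul Z Z) (diagonal_curv_apply W Z))) _.
by move=> A B psi; field.
Qed.

Lemma scalar_curv_zetaphi2 : (2 < d)%N ->
  scalar_curv true 3 (fun A B psi => zeta A B psi * phi A B psi ^+ 2).
Proof.
move=> d2; apply: (@scalar_curv_divide _ _ _
  (dR * (dR - 1) * (dR - 2) * (dR + 1) ^+ 2 / 2)).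
  by rewrite !mulf_neq0 ?expf_neq0 ?dim2_neq0 ?dim1_neq0 ?dimR_neq0 ?dimB1_neq0 ?dimB2_neq0 // invr_eq0 pnatr_eq0.
apply: scalar_curv_ext (diagonal_curv_trace (diagonal_curv_mul Z W2)) _.
by move=> A B psi; field.
Qed.

Lemma scalar_curv_zetaphi3 : (2 < d)%N ->
  scalar_curv true 4 (fun A B psi => zeta A B psi * phi A B psi ^+ 3).
Proof.
move=> d2; apply: (@scalar_curv_divide _ _ _
  (2 * dR * (dR - 1) * ((dR - 1) ^+ 2 * (dR ^+ 3 - dR + 2) / 8 - 1))).
  have [e e0 dE] : exists2 e : R, 0 <= e & dR = e + 3.
    by exists (d - 3)%N%:R => //; rewrite -natrD subnK.
  rewrite !mulf_neq0 ?dimR_neq0 ?dimB1_neq0 ?pnatr_eq0 // dE gt_eqF //.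
  (* Crude bounds for d >= 3: the last factor is at least 4 * 8 / 8 - 1 = 3. At d = 2 it would be
     0. *)
  have a1 : 4 <= (e + 3 - 1) ^+ 2 by have := mulr_ge0 e0 e0; nra.
  have a2 : 8 <= (e + 3) ^+ 3 - (e + 3) + 2.
    have := mulr_ge0 e0 (mulr_ge0 e0 e0); have := mulr_ge0 e0 e0; nra.
  have : 4 * 8 <= (e + 3 - 1) ^+ 2 * ((e + 3) ^+ 3 - (e + 3) + 2).
    by apply: ler_pM.
  by lra.
apply: scalar_curv_ext (diagonal_curv_trace (diagonal_curv_mul Z W3)) _.
by move=> A B psi; field.
Qed.

Lemma scalar_curv_zeta j : j != 1%N -> (2 < d)%N || ~~ odd j ->
  scalar_curv (0 < j)%N j (fun A B psi => zeta A B psi ^+ j).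
Proof.
have [n] := ubnP j; elim: n j => // n IH [|[|[|[|j]]]] // jn _ dj.
- exact: scalar_curv_one.
- exact: scalar_curv_zeta2.
- by apply: scalar_curv_zeta3; rewrite orbF in dj.
have dj' : (2 < d)%N || ~~ odd j.+2 by move: dj; rewrite /= !negbK.
have H := scalar_curv_mul scalar_curv_zeta2
  (IH j.+2 ltac:(by rewrite -ltnS (ltn_trans _ jn)) erefl dj').
by apply: scalar_curv_ext H _ => A B psi; rewrite -exprD.
Qed.

(** These exponents of [zeta] and [phi] belong to no full contraction: the traceless Ricci and the
    Weyl tensor have zero traces, and so has every contraction of one with the other. *)
Definition bad_degrees (j l : nat) : bool :=
  [|| (j == 1) && (l == 0), (j == 0) && (l == 1) | (j == 1) && (l == 1)]%N.

(** The pairs (2,0), (3,0), (0,2), (0,3), (2,1), (3,1), (1,2), (1,3), obtained from traces, generate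
    all the others. The traces used for odd [j] carry constants that vanish at d = 2, hence the
    parity condition. *)
Lemma scalar_curv_zetaphi j l : ~~ bad_degrees j l -> (2 < d)%N || ~~ odd j ->
  scalar_curv (0 < j)%N (j + l) (fun A B psi => zeta A B psi ^+ j * phi A B psi ^+ l).
Proof.
case: j => [|[|j]].
- move=> bl _; have l1 : l != 1%N by move: bl; case: l => [|[|l]].
  by apply: scalar_curv_ext (scalar_curv_phi l1) _ => A B psi; rewrite mul1r.
- rewrite orbF; case: l => [|[|[|[|l]]]] // _ d2.
  + exact: scalar_curv_zetaphi2.
  + exact: scalar_curv_zetaphi3.
  have H := scalar_curv_mul (scalar_curv_zetaphi2 d2) (@scalar_curv_phi l.+2 isT).
  by apply: scalar_curv_ext H _ => A B psi; rewrite expr1 -mulrA -exprD.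
case: l => [|[|l]] _ dj.
- have H := @scalar_curv_zeta j.+2 isT dj.
  by rewrite addn0; apply: scalar_curv_ext H _ => A B psi; rewrite mulr1.
- case: j dj => [|[|j]] dj.
  + exact: scalar_curv_zeta2phi.
  + by apply: scalar_curv_zeta3phi; rewrite orbF in dj.
  have dj' : (2 < d)%N || ~~ odd j.+2 by move: dj; rewrite /= !negbK.
  have H := scalar_curv_mul (@scalar_curv_zeta j.+2 isT dj') scalar_curv_zeta2phi.
  have -> : (j.+4 + 1 = j.+2 + 3)%N by rewrite addn1 addn3.
  by apply: scalar_curv_ext H _ => A B psi; rewrite mulrA -exprD addn2.
have H := scalar_curv_mul (@scalar_curv_zeta j.+2 isT dj) (@scalar_curv_phi l.+2 isT).
exact: scalar_curv_ext H _.
Qed.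

Lemma scalar_curv_rhoX k : scalar_curv (0 < k)%N k (fun A B psi => rho A B psi ^+ k).
Proof.
elim: k => [|k IH]; first exact: scalar_curv_one.
have := scalar_curv_mul scalar_curv_rho IH => H.
by apply: scalar_curv_ext H _ => A B psi; rewrite exprS.
Qed.

Lemma scalar_curv_monomial k j l : ~~ bad_degrees j l -> (2 < d)%N || ~~ odd j ->
  scalar_curv ((0 < k) || (0 < j))%N (k + j + l)
    (fun A B psi => rho A B psi ^+ k * zeta A B psi ^+ j * phi A B psi ^+ l).
Proof.
move=> bjl dj; have := scalar_curv_mul (scalar_curv_rhoX k) (scalar_curv_zetaphi bjl dj) => H.
by rewrite -addnA; apply: scalar_curv_ext H _ => A B psi; rewrite mulrA.
Qed.

End Generators.

(** * Homogeneous forms in three variables and their lowest coefficients *)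

Section HomogeneousForms.
Context {R : realType}.
Implicit Types (s : seq (R * (nat * nat * nat))) (P : R -> R -> R -> R).

(* [(a, (k, i, j))] stands for the monomial a x^k y^i z^j. *)
Definition monomial (m : R * (nat * nat * nat)) (x y z : R) : R :=
  m.1 * (x ^+ m.2.1.1 * y ^+ m.2.1.2 * z ^+ m.2.2).

Definition yz_coef s (i j : nat) : R :=
  \sum_(m <- s | (m.2.1.2 == i) && (m.2.2 == j)) m.1.

Definition homogeneous n s : bool :=
  all (fun m => m.2.1.1 + m.2.1.2 + m.2.2 == n)%N s.

(** Only the coefficients of degree at most 1 in y and in z are recorded; homogeneity determines the
    power of x. They include those of the excluded monomials, and they propagate through sums and
    products with linear forms of x-coefficient 1 without expanding the rest. *)
Definition hom_form n P (e00 e10 e01 e11 : R) : Prop :=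
  exists s, [/\ homogeneous n s, forall x y z, P x y z = \sum_(m <- s) monomial m x y z &
    [/\ yz_coef s 0 0 = e00, yz_coef s 1 0 = e10, yz_coef s 0 1 = e01 &
        yz_coef s 1 1 = e11]].

Lemma hom_form_ext n P Q a b c e a' b' c' e' : hom_form n P a b c e ->
  (forall x y z, P x y z = Q x y z) -> a = a' -> b = b' -> c = c' -> e = e' ->
  hom_form n Q a' b' c' e'.
Proof.
move=> [s [hs sP [sa sb sc se]]] PQ <- <- <- <-; exists s; split => // x y z.
by rewrite -PQ sP.
Qed.

Lemma hom_form0 n : hom_form n (fun _ _ _ => 0) 0 0 0 0.
Proof.
exists [::]; split => //; first by move=> x y z; rewrite big_nil.
by rewrite /yz_coef !big_nil.
Qed.

Lemma hom_form1 : hom_form 0 (fun _ _ _ => 1) 1 0 0 0.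
Proof.
exists [:: (1, (0, 0, 0)%N)]; split => //.
  by move=> x y z; rewrite big_seq1 /monomial /= !mulr1.
by rewrite /yz_coef !big_cons !big_nil /= !addr0.
Qed.

Lemma hom_formD n P Q a b c e a' b' c' e' :
  hom_form n P a b c e -> hom_form n Q a' b' c' e' ->
  hom_form n (fun x y z => P x y z + Q x y z) (a + a') (b + b') (c + c') (e + e').
Proof.
move=> [s [hs sP [<- <- <- <-]]] [s' [hs' sQ [<- <- <- <-]]]; exists (s ++ s').
split; first by rewrite /homogeneous all_cat; apply/andP.
  by move=> x y z; rewrite big_cat /= sP sQ.
by rewrite /yz_coef !big_cat.
Qed.

Lemma yz_coef_map s (f : R * (nat * nat * nat) -> R * (nat * nat * nat)) u i j i' j' :
  (forall m, (f m).1 = u * m.1) ->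
  (forall m, ((f m).2.1.2 == i') && ((f m).2.2 == j') = (m.2.1.2 == i) && (m.2.2 == j)) ->
  yz_coef (map f s) i' j' = u * yz_coef s i j.
Proof.
move=> f1 f2; rewrite /yz_coef big_map mulr_sumr.
by rewrite (eq_bigl _ _ f2); apply: eq_bigr => m _; exact: f1.
Qed.

Lemma yz_coef_map0 s (f : R * (nat * nat * nat) -> R * (nat * nat * nat)) i' j' :
  (forall m, ((f m).2.1.2 == i') && ((f m).2.2 == j') = false) ->
  yz_coef (map f s) i' j' = 0.
Proof. by move=> f2; rewrite /yz_coef big_map big_pred0. Qed.

Lemma hom_formZ n P u a b c e : hom_form n P a b c e ->
  hom_form n (fun x y z => u * P x y z) (u * a) (u * b) (u * c) (u * e).
Proof.
move=> [s [hs sP [<- <- <- <-]]]; exists [seq (u * m.1, m.2) | m <- s]; split.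
- by rewrite /homogeneous all_map.
- by move=> x y z; rewrite big_map sP mulr_sumr; apply: eq_bigr => m _; rewrite /monomial mulrA.
by split; apply: yz_coef_map.
Qed.

Lemma hom_form_linear n P v w a b c e : hom_form n P a b c e ->
  hom_form n.+1 (fun x y z => (x + v * y + w * z) * P x y z)
    a (b + v * a) (c + w * a) (e + v * c + w * b).
Proof.
move=> [s [hs sP [<- <- <- <-]]].
pose fx (m : R * (nat * nat * nat)) := (m.1, (m.2.1.1.+1, m.2.1.2, m.2.2)).
pose fy (m : R * (nat * nat * nat)) := (v * m.1, (m.2.1.1, m.2.1.2.+1, m.2.2)).
pose fz (m : R * (nat * nat * nat)) := (w * m.1, (m.2.1.1, m.2.1.2, m.2.2.+1)).
exists (map fx s ++ (map fy s ++ map fz s)); split.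
- rewrite /homogeneous !all_cat !all_map; apply/and3P; split; apply: sub_all hs => m /eqP <- /=;
  by rewrite ?addSn ?addnS.
- move=> x y z; rewrite sP !big_cat /= !big_map !mulrDl !mulr_sumr addrA.
  congr (_ + _ + _); apply: eq_bigr => m _;
  by rewrite /monomial /= exprS; ring.
have cat i j : yz_coef (map fx s ++ (map fy s ++ map fz s)) i j =
    yz_coef (map fx s) i j + yz_coef (map fy s) i j + yz_coef (map fz s) i j.
  by rewrite /yz_coef !big_cat /= addrA.
have X i j : yz_coef (map fx s) i j = yz_coef s i j.
  by rewrite -[RHS]mul1r; apply: yz_coef_map => // m; rewrite mul1r.
have Y i j : yz_coef (map fy s) i.+1 j = v * yz_coef s i j by exact: yz_coef_map.
have Y0 j : yz_coef (map fy s) 0 j = 0 by exact: yz_coef_map0.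
have Z i j : yz_coef (map fz s) i j.+1 = w * yz_coef s i j by exact: yz_coef_map.
have Z0 i : yz_coef (map fz s) i 0 = 0.
  by apply: yz_coef_map0 => m; rewrite andbF.
by split; rewrite cat X ?Y ?Y0 ?Z ?Z0 ?addr0.
Qed.

Lemma hom_form_linearX n P v w k a b c e : hom_form n P a b c e ->
  hom_form (k + n)%N (fun x y z => (x + v * y + w * z) ^+ k * P x y z)
    a (b + k%:R * v * a) (c + k%:R * w * a)
    (e + k%:R * v * c + k%:R * w * b + (k%:R ^+ 2 - k%:R) * v * w * a).
Proof.
move=> H; elim: k => [|k IH].
  by apply: hom_form_ext H _ _ _ _ _ => [x y z|//|||]; ring.
by apply: hom_form_ext (hom_form_linear v w IH) _ _ _ _ _ => [x y z|//|||];
  rewrite -?natr1 ?exprS; ring.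
Qed.

(** Averaging over the sign of y allows all monomials odd in y to be dropped from the list without
    changing any value. *)
Lemma hom_form_even n P a c (b e : R) : hom_form n P a b c e ->
  (forall x y z, P x (- y) z = P x y z) ->
  exists s, [/\ homogeneous n s, all (fun m => ~~ odd m.2.1.2) s,
    forall x y z, P x y z = \sum_(m <- s) monomial m x y z & yz_coef s 0 1 = c].
Proof.
move=> [s [hs sP [_ _ <- _]]] evP; exists [seq m <- s | ~~ odd m.2.1.2]; split.
- by rewrite /homogeneous all_filter; apply: sub_all hs => m /= ->; rewrite implybT.
- exact: filter_all.
- move=> x y z; have E : P x y z = 2^-1 * (P x y z + P x (- y) z) by rewrite evP; field.
  rewrite E !sP -big_split big_filter mulr_sumr [RHS]big_mkcond /=.
  apply: eq_bigr => m _; rewrite /monomial exprNn -signr_odd.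
  by case: (odd _) => /=; rewrite ?expr1 ?expr0; field.
- rewrite /yz_coef big_filter_cond; apply: eq_bigl => m.
  by case: eqP => [->|]; rewrite ?andbF.
Qed.

End HomogeneousForms.

(** * Forms that are values of contractions *)

Section Corrections.
Context {R : realType} {d : nat}.
Local Notation D := d.+2.
Local Notation scalar_curv := (@scalar_curv R d).
Local Notation rho := (@rho R d).
Local Notation zeta := (@zeta R d).
Local Notation phi := (@phi R d).
Hypothesis d_gt0 : (0 < d)%N.
Hypothesis d_gt1 : (1 < d)%N.
Implicit Types (s : seq (R * (nat * nat * nat))).

Lemma scalar_curv_sum n s : (0 < n)%N ->
  all (fun m => [&& m.2.1.1 + m.2.1.2 + m.2.2 == n, ~~ bad_degrees m.2.1.2 m.2.2,
    (2 < d) || ~~ odd m.2.1.2 & (0 < m.2.1.1) || (0 < m.2.1.2)])%N s ->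
  scalar_curv true n (fun A B psi =>
    \sum_(m <- s) monomial m (rho A B psi) (zeta A B psi) (phi A B psi)).
Proof.
move=> n0; elim: s => [_|m s IH /= /andP[/and4P[/eqP mn mb mo m0] /IH H]].
  have := scalar_curv_scale 0 (@scalar_curv_rhoX R d n); rewrite n0 => H0.
  by apply: scalar_curv_ext H0 _ => A B psi; rewrite big_nil mul0r.
have Hm := @scalar_curv_monomial R d d_gt0 d_gt1 m.2.1.1 m.2.1.2 m.2.2 mb mo.
rewrite mn m0 in Hm.
apply: scalar_curv_ext (scalar_curv_add (scalar_curv_scale m.1 Hm) H) _ => A B psi.
by rewrite big_cons.
Qed.

(** By homogeneity the bad monomials with given exponents of [zeta] and [phi] share one power
    product, so they cancel when the coefficient is 0. Evaluation at (0, 0, 1) extracts the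
    coefficient of [phi ^+ n], since [0 ^+ 0 = 1]; every other monomial contains [rho] or [zeta]. *)
Lemma good_monomials n s : (1 < n)%N -> homogeneous n s ->
  all (fun m => (2 < d) || ~~ odd m.2.1.2)%N s ->
  yz_coef s 1 0 = 0 -> yz_coef s 0 1 = 0 -> yz_coef s 1 1 = 0 ->
  scalar_curv true n (fun A B psi =>
    \sum_(m <- s) monomial m (rho A B psi) (zeta A B psi) (phi A B psi)
    - (\sum_(m <- s) monomial m 0 0 1) * phi A B psi ^+ n).
Proof.
move=> n1 hs ev c10 c01 c11.
pose bad (m : R * (nat * nat * nat)) := bad_degrees m.2.1.2 m.2.2.
pose pure (m : R * (nat * nat * nat)) := (m.2.1.1 == 0%N) && (m.2.1.2 == 0%N).
pose s' := [seq m <- s | ~~ bad m && ~~ pure m].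
have n0 : (0 < n)%N by exact: ltnW.
have H : scalar_curv true n (fun A B psi =>
    \sum_(m <- s') monomial m (rho A B psi) (zeta A B psi) (phi A B psi)).
  apply: scalar_curv_sum => //; apply/allP => m; rewrite mem_filter => /andP[/andP[mb mp] ms].
  apply/and4P; split => //; [exact: (allP hs)|exact: (allP ev)|].
  by move: mp; rewrite /pure negb_and !lt0n.
apply: scalar_curv_ext H _ => A B psi.
set x := rho _ _ _; set y := zeta _ _ _; set z := phi _ _ _.
have degm m : m \in s -> (m.2.1.1 + m.2.1.2 + m.2.2 = n)%N by move=> /(allP hs)/eqP.
have bad0 : \sum_(m <- s | bad m) monomial m x y z = 0.
  have part i j : yz_coef s i j = 0 ->
      \sum_(m <- s | (m.2.1.2 == i) && (m.2.2 == j)) monomial m x y z = 0.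
    move=> c0; rewrite big_seq_cond.
    rewrite (eq_bigr (fun m => m.1 * (x ^+ (n - i - j) * y ^+ i * z ^+ j))).
      by rewrite -big_seq_cond -mulr_suml -/(yz_coef s i j) c0 mul0r.
    move=> m /andP[/degm mn /andP[/eqP mi /eqP mj]].
    by rewrite /monomial mi mj -mn mi mj -addnA -subnDA addnK.
  have := part 1%N 0%N c10; have := part 0%N 1%N c01; have := part 1%N 1%N c11.
  rewrite !(big_mkcond (fun m => _ && _)) => p11 p01 p10.
  rewrite big_mkcond /=.
  rewrite (eq_bigr (fun m =>
     (if (m.2.1.2 == 1%N) && (m.2.2 == 0%N) then monomial m x y z else 0)
     + (if (m.2.1.2 == 0%N) && (m.2.2 == 1%N) then monomial m x y z else 0)
     + (if (m.2.1.2 == 1%N) && (m.2.2 == 1%N) then monomial m x y z else 0))).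
    by rewrite !big_split /= p11 p01 p10 !addr0.
  move=> [m1 [[k i] j]] _; rewrite /bad /bad_degrees /=.
  by case: i => [|[|i]]; case: j => [|[|j]]; rewrite /= ?addr0 ?add0r.
rewrite [\sum_(m <- s) monomial m x y z](bigID bad) /= bad0 add0r.
rewrite [X in X - _](bigID pure) /= addrC big_filter.
rewrite -addrA; rewrite [X in _ = _ + X](_ : _ = 0) ?addr0 //; apply/eqP; rewrite subr_eq0; apply/eqP.
rewrite mulr_suml big_mkcond [RHS]big_seq [LHS]big_seq; apply: eq_bigr => m /degm mn.
rewrite /pure /bad /monomial; case: ifPn => [/andP[mb /andP[/eqP k0 /eqP i0]]|].
  by move: mn; rewrite k0 i0 !add0n => ->; rewrite !expr0 expr1n !mul1r mulr1.
rewrite negb_and negbK => /orP[mb|].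
  have [k0|k0] := eqVneq m.2.1.1 0%N; last by rewrite expr0n (negbTE k0) !mul0r mulr0 mul0r.
  have [i0|i0] := eqVneq m.2.1.2 0%N; last by rewrite (expr0n _ m.2.1.2) (negbTE i0) mulr0 !mul0r mulr0 mul0r.
  (* A bad monomial without [rho] and [zeta] is a multiple of [phi], of degree 1 < n. *)
  move: mb mn; rewrite k0 i0 /bad_degrees /= orbF => /eqP -> n1'.
  by rewrite -n1' in n1.
rewrite negb_and => /orP[k0|i0].
  by rewrite expr0n (negbTE k0) !mul0r mulr0 mul0r.
by rewrite (expr0n _ m.2.1.2) (negbTE i0) mulr0 !mul0r mulr0 mul0r.
Qed.

Lemma hom_form_correction n P a : (1 < n)%N -> hom_form n P a 0 0 0 ->
  (d = 2%N -> forall x y z, P x (- y) z = P x y z) ->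
  scalar_curv true n (fun A B psi =>
    P (rho A B psi) (zeta A B psi) (phi A B psi) - P 0 0 1 * phi A B psi ^+ n).
Proof.
move=> n1 HP evP.
have [d2|d2] := eqVneq d 2%N.
  have [s [hs es sP c01]] := hom_form_even HP (evP d2).
  have odd0 j : yz_coef s 1 j = 0.
    rewrite /yz_coef big_seq_cond big_pred0 // => m.
    have [ms|//] := boolP (m \in s); have := allP es m ms.
    by case: eqP => // ->.
  have H := @good_monomials n s n1 hs (sub_all _ es) (odd0 _) c01 (odd0 _).
  apply: scalar_curv_ext (H _) _; first by move=> m ->; rewrite orbT.
  by move=> A B psi; rewrite !sP.
have [s [hs sP [_ c10 c01 c11]]] := HP.
have d3 : (2 < d)%N by rewrite ltn_neqAle eq_sym d2.
have es : all (fun m => (2 < d) || ~~ odd m.2.1.2)%N s by apply/allP => m _; rewrite d3.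
by apply: scalar_curv_ext (good_monomials n1 hs es c10 c01 c11) _ => A B psi; rewrite !sP.
Qed.

End Corrections.

(** * Total derivatives *)

Section TotalDerivatives.
Context {R : realType} {d : nat}.
Local Notation dR := (d%:R : R).

(* On a profile f, r^d times this is the derivative of r^(d+1) B^i psi^j. *)
Definition total_derivative (i j : nat) (A B psi : R) : R :=
  (dR + 1) * (B ^+ i * psi ^+ j) + i%:R * ((A - B) * B ^+ i.-1 * psi ^+ j)
  + 2 * j%:R * ((B - psi) * B ^+ i * psi ^+ j.-1).

(** Coefficients of the inverse change of variables: A, B and psi are the linear forms [LA], [LB]
    and [LP] in x = [rho], y = [zeta], z = [phi]. *)
Let A2 : R := dR * (dR - 1) / 2.
Let B1 : R := (dR - 2) / dR.
Let B2 : R := - (dR - 1) / 2.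
Let P1 : R := - 4 / dR.

Local Notation LA x y z := (x + 2 * y + A2 * z).
Local Notation LB x y z := (x + B1 * y + B2 * z).
Local Notation LP x y z := (x + P1 * y + 1 * z).

(** [X], [Y] and [M] are the coefficients of y, z and yz, up to powers of x, in the product of the
    powers a, b, c of the three linear forms. Subtracting the diagonal terms in [M] removes the
    choice of y and z from the same factor. *)
Let X (a b c : R) : R := a * 2 + b * B1 + c * P1.
Let Y (a b c : R) : R := a * A2 + b * B2 + c.
Let M (a b c : R) : R := X a b c * Y a b c - (a * 2 * A2 + b * B1 * B2 + c * P1).

Lemma hom_form_product a b c :
  hom_form (a + (b + (c + 0)))%N
    (fun x y z => LA x y z ^+ a * (LB x y z ^+ b * LP x y z ^+ c))
    1 (X a%:R b%:R c%:R) (Y a%:R b%:R c%:R) (M a%:R b%:R c%:R).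
Proof.
have H := hom_form_linearX 2 A2 a (hom_form_linearX B1 B2 b
  (hom_form_linearX P1 1 c (@hom_form1 R))).
by apply: hom_form_ext H _ _ _ _ _ => [x y z||||]; rewrite ?mulr1 // /M /X /Y; ring.
Qed.

(** Collecting terms gives (d + 1 - i - 2j) B^i psi^j + i A B^(i-1) psi^j + 2j B^(i+1) psi^(j-1),
    three products of linear forms. Predecessors truncated at 0 are harmless because their factor i
    or j is then 0. *)
Lemma hom_form_total_derivative i j :
  hom_form (i + j)%N
    (fun x y z => total_derivative i j (LA x y z) (LB x y z) (LP x y z))
    (dR + 1)
    ((dR + 1 - i%:R - 2 * j%:R) * X 0 i%:R j%:R
      + i%:R * X 1 (i%:R - 1) j%:R + 2 * j%:R * X 0 (i%:R + 1) (j%:R - 1))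
    ((dR + 1 - i%:R - 2 * j%:R) * Y 0 i%:R j%:R
      + i%:R * Y 1 (i%:R - 1) j%:R + 2 * j%:R * Y 0 (i%:R + 1) (j%:R - 1))
    ((dR + 1 - i%:R - 2 * j%:R) * M 0 i%:R j%:R
      + i%:R * M 1 (i%:R - 1) j%:R + 2 * j%:R * M 0 (i%:R + 1) (j%:R - 1)).
Proof.
have H1 := hom_formZ (dR + 1 - i%:R - 2 * j%:R) (hom_form_product 0 i j).
rewrite !addn0 add0n in H1.
have H2 : hom_form (i + j)%N
    (fun x y z => i%:R * (LA x y z * (LB x y z ^+ i.-1 * LP x y z ^+ j)))
    i%:R (i%:R * X 1 (i%:R - 1) j%:R) (i%:R * Y 1 (i%:R - 1) j%:R)
    (i%:R * M 1 (i%:R - 1) j%:R).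
  case: i {H1} => [|i].
    by apply: hom_form_ext (hom_form0 _) _ _ _ _ _ => [x y z||||]; rewrite mulr0n ?mul0r.
  have := hom_formZ i.+1%:R (hom_form_product 1 i j); rewrite addn0 add1n -addSn => H.
  apply: hom_form_ext H _ _ _ _ _ => [x y z||||]; rewrite ?mulr1 //.
  - by rewrite -[i.+1%:R]natr1 addrK.
  - by rewrite -[i.+1%:R]natr1 addrK.
  - by rewrite -[i.+1%:R]natr1 addrK.
have H3 : hom_form (i + j)%N
    (fun x y z => 2 * j%:R * (LB x y z ^+ i.+1 * LP x y z ^+ j.-1))
    (2 * j%:R) (2 * j%:R * X 0 (i%:R + 1) (j%:R - 1))
    (2 * j%:R * Y 0 (i%:R + 1) (j%:R - 1)) (2 * j%:R * M 0 (i%:R + 1) (j%:R - 1)).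
  case: j {H1 H2} => [|j].
    by apply: hom_form_ext (hom_form0 _) _ _ _ _ _ => [x y z||||]; rewrite mulr0n mulr0 ?mul0r.
  have := hom_formZ (2 * j.+1%:R) (hom_form_product 0 i.+1 j); rewrite addn0 add0n addSnnS => H.
  apply: hom_form_ext H _ _ _ _ _ => [x y z||||]; rewrite ?mulr1 //.
  - by rewrite expr0 mul1r.
  - by rewrite -[j.+1%:R]natr1 -[i.+1%:R]natr1 addrK.
  - by rewrite -[j.+1%:R]natr1 -[i.+1%:R]natr1 addrK.
  - by rewrite -[j.+1%:R]natr1 -[i.+1%:R]natr1 addrK.
apply: hom_form_ext (hom_formD (hom_formD H1 H2) H3) _ _ _ _ _ => [x y z||||] //.
  rewrite /total_derivative expr0 mul1r.
  case: i {H1 H2 H3} => [|i]; case: j => [|j]; rewrite ?expr0 ?exprS /=; ring.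
by ring.
Qed.

Hypothesis d_gt1 : (1 < d)%N.

Let d_gt0 : (0 < d)%N := ltnW d_gt1.

Variable m : nat.
Let n : R := m%:R + 2.
(** Let G = B^m (al B^2 + be B psi + ga psi^2). The coefficient of [zeta] is d G_B - 2 G_psi at B =
    psi = 1, and [al], [be] make this gradient (4n, 2nd) for any [ga]. The coefficient of
    [zeta * phi] is then affine in [ga] and determines it. *)
Let ga : R := n * (n - 1) * (dR - 2).
Let be : R := 2 * n * dR - 2 * ga.
Let al : R := 4 - 2 * (n - 1) * dR + ga.

(* The weights make the coefficients of zeta rho^(n-1), phi rho^(n-1) and
   zeta phi rho^(n-2) vanish, these being the monomials excluded by
   [bad_degrees].  For d = 2 they also make the polynomial even in zeta. *)
Definition gqt_terms : seq (R * (nat * nat)) :=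
  [:: (al, (m.+2, 0)%N); (be, (m.+1, 1)%N); (ga, (m, 2)%N)].

Definition gqt_polynomial (A B psi : R) : R :=
  \sum_(q <- gqt_terms) q.1 * total_derivative q.2.1 q.2.2 A B psi.

Lemma gqt_polynomialE A B psi : gqt_polynomial A B psi =
  al * total_derivative m.+2 0 A B psi + be * total_derivative m.+1 1 A B psi
  + ga * total_derivative m 2 A B psi.
Proof. by rewrite /gqt_polynomial !big_cons big_nil /= addr0 addrA. Qed.

Lemma hom_form_gqt :
  hom_form m.+2 (fun x y z => gqt_polynomial (LA x y z) (LB x y z) (LP x y z))
    ((al + be + ga) * (dR + 1)) 0 0 0.
Proof.
have d0 := @dimR_neq0 R d d_gt0.
have H0 := hom_formZ al (hom_form_total_derivative m.+2 0); rewrite addn0 in H0.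
have H1 := hom_formZ be (hom_form_total_derivative m.+1 1); rewrite addn1 in H1.
have H2 := hom_formZ ga (hom_form_total_derivative m 2); rewrite addn2 in H2.
apply: hom_form_ext (hom_formD (hom_formD H0 H1) H2) _ _ _ _ _ => [x y z||||].
- by rewrite gqt_polynomialE.
- by ring.
- by rewrite /X /be /al /ga /n /A2 /B1 /B2 /P1 -!natr1; field; rewrite ?d0.
- by rewrite /Y /be /al /ga /n /A2 /B1 /B2 /P1 -!natr1; field.
- by rewrite /M /X /Y /be /al /ga /n /A2 /B1 /B2 /P1 -!natr1; field; rewrite ?d0.
Qed.

(** In dimension four a change of sign of [zeta] swaps A and psi and fixes B, as if the (t, r) plane
    and the sphere were exchanged. There [ga = 0], and the polynomial is symmetric under the
    swap. *)
Lemma gqt_even : d = 2%N -> forall x y z,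
  gqt_polynomial (LA x (- y) z) (LB x (- y) z) (LP x (- y) z) =
  gqt_polynomial (LA x y z) (LB x y z) (LP x y z).
Proof.
move=> d2 x y z.
have dE : dR = 2 by rewrite d2.
have -> : LA x (- y) z = LP x y z by rewrite /A2 /P1 dE; field.
have -> : LP x (- y) z = LA x y z by rewrite /A2 /P1 dE; field.
have -> : LB x (- y) z = LB x y z by rewrite /B1 dE; field.
rewrite !gqt_polynomialE.
move: (LA x y z) (LB x y z) (LP x y z) => A B psi.
have -> : ga = 0 by rewrite /ga dE; ring.
rewrite !mul0r !addr0 /total_derivative /be /al /ga /n dE -!natr1 /= !exprS !expr0.
by ring.
Qed.

Lemma gqt_leading_neq0 : gqt_polynomial A2 B2 1 != 0.
Proof.
have dm1 := @dimB1_neq0 R d d_gt1.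
have -> : gqt_polynomial A2 B2 1 = (dR + 1) * (- m%:R - 1) * B2 ^+ m *
    ((n ^+ 2 * (dR ^+ 3 - 3 * dR - 2) - n * (3 * dR ^+ 3 - 5 * dR - 2)
       + 2 * (dR ^+ 3 - 3 * dR + 2)) / 4).
  rewrite gqt_polynomialE /total_derivative.
  (* Since [A2 - B2 = - (dR + 1) * B2], the missing power of [B2] is restored; for m = 0 both sides
     are 0. *)
  have E : m%:R * ((A2 - B2) * B2 ^+ m.-1 * 1 ^+ 2) = - m%:R * (dR + 1) * B2 ^+ m.
    case: (m) => [|k]; first by ring.
    by rewrite /= expr1n [B2 ^+ k.+1]exprS; move: (B2 ^+ k) => b; rewrite /A2 /B2; field.
  rewrite {}E !expr1n -!natr1 /= !exprS; move: (B2 ^+ m) => b.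
  by rewrite /A2 /B2 /be /al /ga /n; field.
have B20 : B2 != 0 by rewrite !mulf_neq0 ?oppr_eq0 ?invr_eq0.
have m1 : - m%:R - 1 != 0 :> R by rewrite -opprD oppr_eq0 natr1 pnatr_eq0.
apply: mulf_neq0; first by rewrite !mulf_neq0 ?dim1_neq0 ?expf_neq0.
apply: mulf_neq0; last by rewrite invr_eq0 pnatr_eq0.
(* The remaining factor has no constant sign: it is negative for n = 2, for d = 2, and for n = 3
   with d = 3, and positive otherwise. *)
rewrite /n; case: (m) => [|[|k]].
- rewrite (_ : _ + _ = - 8 * dR); last by ring.
  by rewrite mulf_neq0 ?dimR_neq0 // oppr_eq0 pnatr_eq0.
- have [->|d3] := eqVneq d 2%N; first by rewrite (_ : _ + _ = - 28) ?oppr_eq0 ?pnatr_eq0 //; ring.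
  have [->|d4] := eqVneq d 3%N; first by rewrite (_ : _ + _ = - 8) ?oppr_eq0 ?pnatr_eq0 //; ring.
  have [q q0 ->] : exists2 q : R, 0 <= q & dR = q + 4.
    exists (d - 4)%N%:R => //; rewrite -natrD subnK //.
    by move: d_gt1 d3 d4; case: (d) => [|[|[|[|]]]].
  rewrite (_ : _ + _ = 2 * (q * q * q) + 24 * (q * q) + 78 * q + 48); last by ring.
  by rewrite gt_eqF // ltr_pwDr // !addr_ge0 // !mulr_ge0.
- have [->|d3] := eqVneq d 2%N.
    rewrite (_ : _ + _ = - (12 * k%:R + 40)) ?oppr_eq0; last by rewrite -!natr1; ring.
    by rewrite gt_eqF // ltr_pwDr // mulr_ge0.
  have [q q0 ->] : exists2 q : R, 0 <= q & dR = q + 3.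
    exists (d - 3)%N%:R => //; rewrite -natrD subnK //.
    by move: d_gt1 d3; case: (d) => [|[|[|]]].
  rewrite (_ : _ + _ = (q + 1) * (q + 4) ^+ 2 * (k%:R + 4) * k%:R
    + (k%:R + 4) * (q * (q + 4) * (q + 5)) + 2 * (q + 2) ^+ 2 * (q + 5)); last first.
    by rewrite -!natr1; ring.
  have k0 : 0 <= k%:R :> R by exact: ler0n.
  rewrite gt_eqF // ltr_wpDl //.
    by rewrite addr_ge0 // !mulr_ge0 ?exprn_ge0 ?addr_ge0.
  by rewrite !mulr_gt0 ?exprn_gt0 // ltr_wpDl.
Qed.

Lemma gqt_correction :
  @scalar_curv R d true m.+2 (fun A B psi =>
    gqt_polynomial A B psi - gqt_polynomial A2 B2 1 * @phi R d A B psi ^+ m.+2).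
Proof.
have d0 := @dimR_neq0 R d d_gt0.
have d1 := @dim1_neq0 R d.
have d2 := @dim2_neq0 R d.
have H := hom_form_correction d_gt0 d_gt1 (isT : (1 < m.+2)%N) hom_form_gqt gqt_even.
apply: scalar_curv_ext H _ => A B psi.
rewrite !(mulr0, add0r, mulr1); congr (gqt_polynomial _ _ _ - _).
- by rewrite /rho /zeta /phi /A2; field; rewrite ?d0 ?d1 ?d2.
- by rewrite /rho /zeta /phi /B1 /B2; field; rewrite ?d0 ?d1 ?d2.
- by rewrite /rho /zeta /phi /P1; field; rewrite ?d0 ?d1 ?d2.
Qed.

End TotalDerivatives.

(** * Euler-Lagrange expression *)

Section EulerLagrange.
Context {R : realType} {d : nat}.
Local Notation dR := (d%:R : R).
Local Notation td := (@total_derivative R d).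

Lemma is_derive_monomial (V : normedModType R) (x v : V) (b p : V -> R) db dp i j :
  is_derive x v b db -> is_derive x v p dp ->
  is_derive x v (fun y => b y ^+ i * p y ^+ j)
    (i%:R * b x ^+ i.-1 * db * p x ^+ j + b x ^+ i * (j%:R * p x ^+ j.-1 * dp)).
Proof. by move=> hb hp; exact: is_derive_mul (is_derive_pow i hb) (is_derive_pow j hp). Qed.

Lemma is_derive_total_derivative (V : normedModType R) (x v : V)
    (a b p : V -> R) da db dp i j :
  is_derive x v a da -> is_derive x v b db -> is_derive x v p dp ->
  is_derive x v (fun y => td i j (a y) (b y) (p y))
    ((dR + 1) * (i%:R * b x ^+ i.-1 * db * p x ^+ j
                 + b x ^+ i * (j%:R * p x ^+ j.-1 * dp))
     + i%:R * ((da - db) * (b x ^+ i.-1 * p x ^+ j)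
        + (a x - b x) * (i.-1%:R * b x ^+ i.-2 * db * p x ^+ j
                 + b x ^+ i.-1 * (j%:R * p x ^+ j.-1 * dp)))
     + 2 * j%:R * ((db - dp) * (b x ^+ i * p x ^+ j.-1)
        + (b x - p x) * (i%:R * b x ^+ i.-1 * db * p x ^+ j.-1
                 + b x ^+ i * (j.-1%:R * p x ^+ j.-2 * dp)))).
Proof.
move=> ha hb hp.
have c (k : R) := is_derive_cst k x v.
have H1 := is_derive_mul (c (dR + 1)) (is_derive_monomial i j hb hp).
have H2 := is_derive_mul (c i%:R) (is_derive_mul
  (is_derive_add ha (is_derive_opp hb)) (is_derive_monomial i.-1 j hb hp)).
have H3 := is_derive_mul (c (2 * j%:R)) (is_derive_mul
  (is_derive_add hb (is_derive_opp hp)) (is_derive_monomial i j.-1 hb hp)).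
have H := is_derive_add (is_derive_add H1 H2) H3.
have -> : (fun y => td i j (a y) (b y) (p y)) = (fun y =>
   cst (dR + 1) y * (b y ^+ i * p y ^+ j)
   + cst i%:R y * ((a y - b y) * (b y ^+ i.-1 * p y ^+ j))
   + cst (2 * j%:R) y * ((b y - p y) * (b y ^+ i * p y ^+ j.-1))).
  by apply/funext => y; rewrite /total_derivative /cst !mulrA.
by apply: is_derive_eq H _; rewrite /cst !mul0r !add0r.
Qed.

Variables (I : set R) (f : R -> R).
Hypothesis I_radial : radial_domain I.
Hypothesis f_adm : admissible_profile I f.

Let a (s : R) : R := - derive1 (derive1 f) s / 2.
Let b (s : R) : R := - derive1 f s / (2 * s).
Let p (s : R) : R := (1 - f s) / s ^+ 2.

Lemma radial_neq0 s : I s -> s != 0.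
Proof. by have [_ pI] := I_radial; move=> /pI; rewrite lt0r => /andP[]. Qed.

Let f_derive s : I s -> is_derive s 1 f (derive1 f s).
Proof. by move=> Is; exact: smooth_is_derive f_adm.1 Is. Qed.

Let f_derive2 s : I s -> is_derive s 1 (derive1 f) (derive1 (derive1 f) s).
Proof. by move=> Is; exact: smooth_is_derive (smooth_derive1 f_adm.1) Is. Qed.

Let f_derive3 s : I s ->
  is_derive s 1 (derive1 (derive1 f)) (derive1 (derive1 (derive1 f)) s).
Proof.
by move=> Is; exact: smooth_is_derive (smooth_derive1 (smooth_derive1 f_adm.1)) Is.
Qed.

Let id_derive (s : R) : is_derive s 1 (fun y : R => y) 1.
Proof. exact: is_derive_id. Qed.

Lemma is_derive_a s : I s ->
  is_derive s 1 a (- derive1 (derive1 (derive1 f)) s / 2).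
Proof.
move=> Is; rewrite -[- _ / 2]addr0 -[X in _ + X](mulr0 (- derive1 (derive1 f) s)).
exact: (is_derive_mul (is_derive_opp (f_derive3 Is)) (is_derive_cst (2^-1 : R) s 1)).
Qed.

Lemma is_derive_b s : I s -> is_derive s 1 b ((a s - b s) / s).
Proof.
move=> Is; have s0 := radial_neq0 Is.
have H1 := is_derive_mul (is_derive_cst (2 : R) s 1) (id_derive s).
have s20 : 2 * s != 0 by rewrite mulf_neq0.
have H2 := @is_derive_inv _ _ s 1 (fun y : R => 2 * y) _ s20 H1.
have H := is_derive_mul (is_derive_opp (f_derive2 Is)) H2.
by apply: is_derive_eq H _; rewrite /cst /a /b; field.
Qed.

Lemma is_derive_p s : I s -> is_derive s 1 p (2 * (b s - p s) / s).
Proof.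
move=> Is; have s0 := radial_neq0 Is.
have s20 : s ^+ 2 != 0 by rewrite expf_neq0.
have H2 := @is_derive_inv _ _ s 1 (fun y : R => y ^+ 2) _ s20 (is_derive_pow 2 (id_derive s)).
have H := is_derive_mul (is_derive_add (is_derive_cst (1 : R) s 1) (is_derive_opp (f_derive Is))) H2.
by apply: is_derive_eq H _; rewrite /cst /b /p /=; field.
Qed.

Let j0 : 'I_3 := ord0.
Let j1 : 'I_3 := lift ord0 (ord0 : 'I_2).
Let j2 : 'I_3 := lift ord0 (lift ord0 (ord0 : 'I_1)).

(** The constant [c] accounts for densities that are constant on these metrics; its contribution
    [s ^+ d * c] does not involve the jet. *)
Definition jet_lagrangian (c : R) (q : seq (R * (nat * nat))) (s : R)
    (j : 'rV[R]_3) : R :=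
  s ^+ d * (c + \sum_(m <- q) m.1 * td m.2.1 m.2.2
    (- j 0 j2 / 2) (- j 0 j1 / (2 * s)) ((1 - j 0 j0) / s ^+ 2)).

(** For H = s^(d+1) B^i psi^j as a function of s, f and f', [u] and [v] are the partial derivatives
    of H in f and f' along the profile; [u'] and [v'] are their derivatives in s. *)
Let u i j s : R := - (j%:R * (s ^+ d / s * (b s ^+ i * p s ^+ j.-1))).
Let v i j s : R := - (i%:R / 2) * (s ^+ d * (b s ^+ i.-1 * p s ^+ j)).
Let u' i j s : R := - (j%:R * ((dR - 1) / s * (s ^+ d / s) * (b s ^+ i * p s ^+ j.-1)
  + s ^+ d / s * (i%:R * b s ^+ i.-1 * ((a s - b s) / s) * p s ^+ j.-1
     + b s ^+ i * (j.-1%:R * p s ^+ j.-2 * (2 * (b s - p s) / s))))).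
Let v' i j s : R := - (i%:R / 2) * (dR * (s ^+ d / s) * (b s ^+ i.-1 * p s ^+ j)
  + s ^+ d * (i.-1%:R * b s ^+ i.-2 * ((a s - b s) / s) * p s ^+ j
     + b s ^+ i.-1 * (j%:R * p s ^+ j.-1 * (2 * (b s - p s) / s)))).

Lemma natmul_pred k (s : R) : s != 0 -> k%:R * s ^+ k.-1 = k%:R * (s ^+ k / s).
Proof. by case: k => [|k] s0; rewrite ?mul0r // exprS mulrAC divff // mul1r. Qed.

Let pow_derive s : I s -> is_derive s 1 (fun y : R => y ^+ d) (dR * (s ^+ d / s)).
Proof.
move=> Is; apply: is_derive_eq (is_derive_pow d (id_derive s)) _.
by rewrite mulr1 natmul_pred // radial_neq0.
Qed.

Let inv_derive s : I s -> is_derive s 1 (fun y : R => y^-1) (- 1 / s ^+ 2).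
Proof. by move=> Is; exact: (@is_derive_inv _ _ s 1 id _ (radial_neq0 Is) (id_derive s)). Qed.

Lemma is_derive_u i j s : I s -> is_derive s 1 (u i j) (u' i j s).
Proof.
move=> Is; have s0 := radial_neq0 Is.
have H := is_derive_opp (is_derive_mul (is_derive_cst (j%:R : R) s 1)
  (is_derive_mul (is_derive_mul (pow_derive Is) (inv_derive Is))
     (is_derive_monomial i j.-1 (is_derive_b Is) (is_derive_p Is)))).
by apply: is_derive_eq H _; rewrite /cst /u'; field.
Qed.

Lemma is_derive_v i j s : I s -> is_derive s 1 (v i j) (v' i j s).
Proof.
move=> Is; have s0 := radial_neq0 Is.
have H := is_derive_mul (is_derive_cst (- (i%:R / 2) : R) s 1)
  (is_derive_mul (pow_derive Is)
     (is_derive_monomial i.-1 j (is_derive_b Is) (is_derive_p Is))).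
by apply: is_derive_eq H _; rewrite /cst /v'; field.
Qed.

(** Existence is enough: this second derivative of [v] occurs twice in the Euler-Lagrange
    expression, with opposite signs. *)
Lemma is_derive_v' i j s : I s -> exists l, is_derive s 1 (v' i j) l.
Proof.
move=> Is; eexists.
have c (k : R) := is_derive_cst k s (1 : R).
have hb := is_derive_b Is; have hp := is_derive_p Is; have ha := is_derive_a Is.
have hi := inv_derive Is; have hd := pow_derive Is.
exact: (is_derive_mul (c (- (i%:R / 2)))
  (is_derive_add
    (is_derive_mul (is_derive_mul (c dR) (is_derive_mul hd hi)) (is_derive_monomial i.-1 j hb hp))
    (is_derive_mul hd (is_derive_add
      (is_derive_mul (is_derive_mul (is_derive_mul (c i.-1%:R) (is_derive_pow i.-2 hb))
          (is_derive_mul (is_derive_add ha (is_derive_opp hb)) hi)) (is_derive_pow j hp))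
      (is_derive_mul (is_derive_pow i.-1 hb)
         (is_derive_mul (is_derive_mul (c j%:R) (is_derive_pow j.-1 hp))
            (is_derive_mul (is_derive_mul (c 2) (is_derive_add hb (is_derive_opp hp))) hi))))))).
Qed.

Local Notation jet s := (profile_jet 2 f s).

(** The term is the total derivative L of H. Its partial derivatives in f, f', f'' are the total
    derivative of dH/df, dH/df plus the total derivative of dH/df', and dH/df'. *)
Lemma is_derive_jet_term i j s (e : 'I_3) : I s ->
  is_derive (jet s) (delta_mx 0 e : 'rV[R]_3)
    (fun w : 'rV[R]_3 => s ^+ d * td i j (- w 0 j2 / 2) (- w 0 j1 / (2 * s))
        ((1 - w 0 j0) / s ^+ 2))
    ((e == j0)%:R * u' i j s + (e == j1)%:R * (u i j s + v' i j s)
     + (e == j2)%:R * v i j s).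
Proof.
move=> Is; have s0 := radial_neq0 Is.
have c (k : R) := is_derive_cst k (jet s) (delta_mx 0 e : 'rV[R]_3).
have X k := is_derive_coord (jet s) (delta_mx 0 e : 'rV[R]_3) k.
have ha := is_derive_mul (is_derive_opp (X j2)) (c 2^-1).
have hb := is_derive_mul (is_derive_opp (X j1)) (c (2 * s)^-1).
have hp := is_derive_mul (is_derive_add (c 1) (is_derive_opp (X j0))) (c (s ^+ 2)^-1).
have H := is_derive_mul (c (s ^+ d)) (is_derive_total_derivative i j ha hb hp).
apply: is_derive_eq H _.
have J0 : jet s 0 j0 = f s by rewrite mxE.
have J1 : jet s 0 j1 = derive1 f s by rewrite mxE.
have J2 : jet s 0 j2 = derive1 (derive1 f) s by rewrite mxE.
rewrite /cst J0 J1 J2 !mxE !eqxx /= -/(a s) -/(b s) -/(p s) !(eq_sym _ e).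
rewrite /u' /u /v' /v.
move: (a s) (b s) (p s) (s ^+ d) => A B P sd.
have e3 : [|| e == j0, e == j1 | e == j2].
  by move: e {X ha hb hp c} => [[|[|[|]]]].
case/or3P: e3 => /eqP ->; rewrite /= ?mulr1n ?mulr0n.
- case: i => [|[|i]]; case: j => [|[|j]]; rewrite /= ?exprS ?expr0;
    by field.
- case: i => [|[|i]]; case: j => [|[|j]]; rewrite /= ?exprS ?expr0;
    by field.
- case: i => [|[|i]]; case: j => [|[|j]]; rewrite /= ?exprS ?expr0;
    by field.
Qed.

(** After summation over the terms the expression is u' - (u + v')' + v'', the primes on the bracket
    and on [v] being derivatives in s, and it cancels. *)
Lemma euler_lagrange_jet_lagrangian c q s : I s ->
  euler_lagrange (jet_lagrangian c q) f s = 0.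
Proof.
move=> Is; have [oI _] := I_radial.
pose S (F : nat -> nat -> R -> R) (y : R) := \sum_(m <- q) m.1 * F m.2.1 m.2.2 y.
have S_derive (F F' : nat -> nat -> R -> R) (y : R) : (forall i j, is_derive y 1 (F i j) (F' i j y)) ->
    is_derive y 1 (S F) (S F' y).
  move=> dF; apply: (@is_derive_bigsum _ _ _ q xpredT y 1 (fun m => cst m.1 * F m.2.1 m.2.2)
    (fun m => m.1 * F' m.2.1 m.2.2 y)) => m _.
  have H := is_derive_mul (is_derive_cst (m.1 : R) y 1) (dF m.2.1 m.2.2).
  by apply: is_derive_eq H _; rewrite mul0r add0r.
have D (y : R) (e : 'I_3) : I y -> 'D_(delta_mx 0 e) (jet_lagrangian c q y) (jet y) =
    (e == j0)%:R * S u' y + (e == j1)%:R * (S u y + S v' y) + (e == j2)%:R * S v y.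
  move=> Iy; apply: is_derive_val.
  have -> : jet_lagrangian c q y = (fun w : 'rV[R]_3 => y ^+ d * c
      + \sum_(m <- q) m.1 * (y ^+ d * td m.2.1 m.2.2 (- w 0 j2 / 2)
          (- w 0 j1 / (2 * y)) ((1 - w 0 j0) / y ^+ 2))).
    apply/funext => w; rewrite /jet_lagrangian mulrDr mulr_sumr; congr (_ + _).
    by apply: eq_bigr => m _; rewrite mulrCA.
  have H := is_derive_add (is_derive_cst (y ^+ d * c) (jet y) (delta_mx 0 e : 'rV[R]_3))
    (@is_derive_bigsum _ _ _ q xpredT _ _ _ _ (fun m _ =>
      is_derive_mul (is_derive_cst (m.1 : R) (jet y) (delta_mx 0 e : 'rV[R]_3))
        (is_derive_jet_term m.2.1 m.2.2 e Iy))).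
  apply: is_derive_eq H _; rewrite add0r /S !mulr_sumr -!big_split /= !mulr_sumr -!big_split /=.
  by apply: eq_bigr => m _; rewrite /cst; ring.
have near (F G : R -> R) (l : R) : (forall y, I y -> G y = F y) -> is_derive s 1 G l ->
    is_derive s 1 F l.
  by move=> FG; apply: is_derive_near oI Is _.
have dE (F : R -> R) (l : R) : is_derive s 1 F l -> derive1 F s = l.
  by move=> dF; rewrite derive1E (is_derive_val dF).
have dv' : exists l, is_derive s 1 (S v') l.
  (* The derivatives are known only to exist, so one is chosen for each pair of exponents. *)
  pose w i j (y : R) := xget (0 : R) [set l | is_derive y 1 (v' i j) l].
  exists (S w s); apply: S_derive => i j.
  have [l hl] := is_derive_v' i j Is.
  by have := @xgetI _ 0 [set l | is_derive s 1 (v' i j) l] l hl.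
have [l hl] := dv'.
have du := S_derive u u' s (fun i j => is_derive_u i j Is).
have dv (y : R) : I y -> is_derive y 1 (S v) (S v' y).
  by move=> Iy; apply: S_derive => i j; exact: is_derive_v.
have E0 : 'D_(delta_mx 0 ord0) (jet_lagrangian c q s) (jet s) = S u' s.
  by rewrite (D s ord0 Is) /= !mul0r mul1r !addr0.
have E1 : derive1 (fun y : R => 'D_(delta_mx 0 j1) (jet_lagrangian c q y) (jet y)) s = S u' s + l.
  apply: dE; apply: near (is_derive_add du hl) => y Iy.
  by rewrite (D y j1 Iy) /= mul0r mul1r mul0r add0r addr0.
have E2 : derive1 (derive1 (fun y : R => 'D_(delta_mx 0 j2) (jet_lagrangian c q y) (jet y))) s = l.
  apply: dE; apply: near hl => y Iy.
  rewrite derive1E; apply/esym/is_derive_val.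
  apply: is_derive_near oI Iy _ (dv y Iy) => z Iz.
  by rewrite (D z j2 Iz) /= !mul0r mul1r !add0r.
have sum3 (F : 'I_3 -> R) : \sum_i F i = F j0 + (F j1 + F j2).
  by rewrite !big_ord_recl big_ord0 addr0.
rewrite /euler_lagrange sum3.
have -> : (-1) ^+ nat_of_ord j0 = 1 :> R by [].
have -> : (-1) ^+ nat_of_ord j1 = -1 :> R by [].
have -> : (-1) ^+ nat_of_ord j2 = 1 :> R by rewrite -[nat_of_ord j2]/2%N expr2 mulrNN mulr1.
rewrite -[X in 1 * X + _]/('D_(delta_mx 0 ord0) (jet_lagrangian c q s) (jet s)) E0.
rewrite -[X in _ + (-1 * X + _)]/(derive1 (fun y : R =>
  'D_(delta_mx 0 j1) (jet_lagrangian c q y) (jet y)) s) E1.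
rewrite -[X in _ + (_ + 1 * X)]/(derive1 (derive1 (fun y : R =>
  'D_(delta_mx 0 j2) (jet_lagrangian c q y) (jet y))) s) E2.
by ring.
Qed.

End EulerLagrange.

(** * Completion *)

Section Completion.
Context {R : realType} {d : nat}.
Local Notation D := d.+2.
Local Notation point := 'rV[R]_D.
Local Notation curvature nabla := (curvature_tensor (R := R) (d := d) nabla).
Implicit Types L Q : invariant_density R d.

Lemma curvature_tensor_nabla k r T : curvature false k r T -> curvature true k r T.
Proof.
elim=> {k r T} //.
- exact: ct_metric.
- exact: ct_riemann.
- by move=> *; exact: ct_product.
- by move=> *; exact: ct_contraction.
- by move=> *; exact: ct_permute.
- by move=> *; exact: ct_add.
- by move=> *; exact: ct_scale.
Qed.

Lemma homogeneous_curvature_invariant k L :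
  homogeneous_invariant false k L -> curvature_invariant L.
Proof.
move=> [T cT LT]; exists 1%N, (fun=> L); split; last first.
  by move=> g x; rewrite big_ord1.
by move=> _; exists k, T => //; exact: curvature_tensor_nabla.
Qed.

Lemma smooth_on_zero (V : normedModType R) (U : set V) :
  smooth_on U (fun=> 0 : R).
Proof.
elim=> [|k IH]; split=> //; try by move=> x _; exact: cst_continuous.
move=> v; split; first by move=> x _; exact: derivable_cst.
have -> : 'D_v (fun=> 0 : R) = (fun=> 0) by apply/funext => x; exact: derive_cst.
exact: IH.
Qed.

Lemma lorentzian_unit (M : 'M[R]_D) : lorentzian M -> M \in unitmx.
Proof.
case=> P uP E; have : P *m M *m P^T \in unitmx.
  rewrite E unitmxE det_diag unitfE; apply/prodf_neq0 => i _; rewrite mxE.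
  by case: ifP => _; rewrite ?oppr_eq0 oner_neq0.
by rewrite !unitmx_mul => /andP[/andP[]].
Qed.

(** The zero current works. *)
Lemma reducible_ricci_flat L :
  (forall g x, ricci_flat_at g x -> L g x = 0) -> reducible L.
Proof.
move=> L0; exists 0%N, setT, (fun _ _ => 0); split.
- exact: openT.
- by move=> a; exact: smooth_on_zero.
- by [].
move=> U g oU [_ lor] flat x Ux; rewrite L0; last first.
  by split; [exact/lorentzian_unit/lor|move=> b c; exact: flat].
rewrite mulr0 big1 // => a _; exact: derive_cst.
Qed.

(** The N = 1 metrics are diagonal with three sectional curvatures at every point, so the values
    there already are the reduced Lagrangian, of second order in f. *)
Lemma gqt_of_diagonal_value k L c q : homogeneous_invariant false k L ->
  (forall g x h A B psi, diagonal_point g x h (sectional A B psi) ->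
     L g x = c + \sum_(m <- q) m.1 * @total_derivative R d m.2.1 m.2.2 A B psi) ->
  gqt_density L.
Proof.
move=> hL LE; split; first exact: homogeneous_curvature_invariant hL.
exists 2%N, (@jet_lagrangian R d c q); split.
- move=> I f rI aI x Ix; rewrite (LE _ _ _ _ _ _ (sss_diagonal_point rI aI Ix)).
  congr (_ * (c + _)); apply: eq_bigr => m _.
  by rewrite /profile_jet !mxE.
- by move=> I f rI aI r Ir; exact: (euler_lagrange_jet_lagrangian rI aI c q Ir).
Qed.

Lemma completable_of_weyl_value n L (T : tensor) (c : R) :
  curvature false n.*2 0 T ->
  (forall g x, ricci_flat_at g x -> T g [::] x = L g x) ->
  (forall g x h A B psi, diagonal_point g x h (sectional A B psi) ->
     T g [::] x = c) ->
  completable L.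
Proof.
move=> cT fT dT; exists (fun g x => T g [::] x).
  apply: (@gqt_of_diagonal_value n.*2 _ c [::]); first by exists T.
  by move=> g x h A B psi gx; rewrite big_nil addr0 (dT _ _ _ _ _ _ gx).
by apply: reducible_ricci_flat => g x fl; rewrite fT // subrr.
Qed.

(** For d = 0 the Schouten coefficients have a zero denominator, and half the Kulkarni-Nomizu
    product of the Ricci tensor with the metric is subtracted instead. For d = 1 the Weyl values on
    planes of the first two kinds carry the factor d - 1 = 0, and no plane is tangent to the
    sphere. *)
Lemma low_dimension_correction : (d <= 1)%N -> exists p q s,
  @sectional_curv R d true 1 p q s /\
  forall A B psi, @weyl_part R d p q s A B psi = (fun _ _ => 0).
Proof.
move=> d1; have [d0|d0] := posnP d.
  do 3 eexists; split; first exact: (ricci_correction (- 2^-1) 0).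
  move=> A B psi; apply/funext => a; apply/funext => b.
  rewrite /weyl_part /sectional; case: ifP => // _.
  have lt2 (i : 'I_D) : (i < 2)%N by rewrite (leq_trans (ltn_ord i)) // d0.
  by rewrite !lt2 d0; field.
have dE : d%:R = 1 :> R by have -> : d = 1%N by apply/eqP; rewrite eqn_leq d1.
have [p [q [s [H pE qE sE]]]] := @weyl_correction R d d0.
exists p, q, s; split => // A B psi; apply/funext => a; apply/funext => b.
rewrite /weyl_part /sectional pE qE dE subrr mulr0 oppr0 !mul0r.
case: eqP => // ab; case: ifP => a2; case: ifP => b2 //.
have v2 (i : 'I_D) : (i < 2)%N = false -> i = 2%N :> nat.
  move=> i2; have := ltn_ord i; move: i2.
  by case: (nat_of_ord i) => [|[|[|k]]] // _; rewrite !ltnS => /leq_trans/(_ d1).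
by case: ab; apply/val_inj; rewrite /= (v2 a a2) (v2 b b2).
Qed.

Lemma sectional_tracefree (x : R) :
  (1 < d)%N -> \sum_a \sum_b (sectional (d%:R * (d%:R - 1) / 2 * x) (- (d%:R - 1) / 2 * x) x
     : 'I_D -> 'I_D -> R) a b = 0.
Proof.
move=> d1; rewrite exchange_big /=.
have row (u v w : R) (b : 'I_D) : \sum_a sectional u v w a b =
    pick_block b (u + d%:R * v) (2 * v + (d%:R - 1) * w).
  have := sectional_row u v w 1 1 b; rewrite !mulr1 => <-.
  by apply: eq_bigr => a _; rewrite /pick_block if_same mulr1.
under eq_bigr do rewrite row.
by rewrite sum_blocks; field.
Qed.

Lemma homogeneous_completable k L :
  homogeneous_invariant false k L -> completable L.
Proof.
move=> [T cT LT]; have [d1|d1] := leqP d 1.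
  have [p [q [s [H W0]]]] := low_dimension_correction d1.
  have [n [T' [t [kn cT' fT' dT' _]]]] := curvature_weyl_form H cT.
  rewrite kn in cT'.
  apply: (completable_of_weyl_value (c := t [::] (fun _ _ => 0)) cT').
    by move=> g x fl; rewrite fT' // LT.
  move=> g x h A B psi gx; rewrite (dT' _ _ _ _ _ _ gx) //.
  by rewrite index_weight_nil mul1r W0.
have d0 : (0 < d)%N by exact: ltnW.
have [p [q [s [H pE qE sE]]]] := @weyl_correction R d d0.
have [n [T' [t [kn cT' fT' dT' sT']]]] := curvature_weyl_form H cT.
(* The Weyl array at [phi = 1]; [t [::] w0] is the Deser-Ryzhov constant of the contraction. *)
pose w0 : 'I_D -> 'I_D -> R := sectional (d%:R * (d%:R - 1) / 2) (- (d%:R - 1) / 2) 1.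
have wE A B psi : weyl_part p q s A B psi = (fun a b => @phi R d A B psi * w0 a b).
  apply/funext => a; apply/funext => b; rewrite /weyl_part pE qE sE /w0 /sectional.
  by do ![case: ifP => _]; field.
have T'E g x h A B psi : diagonal_point g x h (sectional A B psi) ->
    T' g [::] x = t [::] w0 * @phi R d A B psi ^+ n.
  move=> gx; rewrite (dT' _ _ _ _ _ _ gx) // index_weight_nil mul1r wE.
  by have [_ -> // _ _] := sT'; rewrite mulrC.
have fT g x : ricci_flat_at g x -> T' g [::] x = L g x.
  by move=> fl; rewrite fT' // LT.
(* Degree 0 gives a constant and degree 1 gives 0, a single Weyl tensor having no nonzero trace; the
   correction enters from degree 2 on. *)
rewrite kn in cT'; case: n kn cT' sT' T'E => [|[|n]] kn cT' sT' T'E.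
- apply: (completable_of_weyl_value (c := t [::] w0) cT' fT).
  by move=> g x h A B psi gx; rewrite (T'E _ _ _ _ _ _ gx) mulr1.
- apply: (completable_of_weyl_value (c := 0) cT' fT).
  move=> g x h A B psi gx; rewrite (T'E _ _ _ _ _ _ gx).
  rewrite (contraction_scheme_tracefree sT') ?mul0r //.
    by move=> a; exact: sectional_diag.
  by have := sectional_tracefree 1 d1; rewrite !mulr1.
set c0 := t [::] w0 in T'E.
have [C [cC vC pC]] := @gqt_correction R d d1 n.
have c1_neq0 := @gqt_leading_neq0 R d d1 n.
set c1 := @gqt_polynomial R d n (d%:R * (d%:R - 1) / 2) _ 1 in pC c1_neq0.
pose Q := (fun g x => T' g [::] x + c0 / c1 * C g [::] x) : invariant_density R d.
have hQ : homogeneous_invariant false n.+2.*2 Q.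
  exists (fun g s x => T' g s x + c0 / c1 * C g s x) => //.
  by apply: ct_add => //; exact: ct_scale.
exists Q.
  apply: (@gqt_of_diagonal_value n.+2.*2 Q 0
    [seq (c0 / c1 * m.1, m.2) | m <- @gqt_terms R d n]) => //.
  move=> g x h A B psi gx; rewrite add0r big_map /Q (T'E _ _ _ _ _ _ gx) (pC _ _ _ _ _ _ gx).
  under [RHS]eq_bigr do rewrite /= -mulrA.
  rewrite -mulr_sumr -/(@gqt_polynomial R d n A B psi); field.
  exact: c1_neq0.
apply: reducible_ricci_flat => g x fl.
by rewrite /Q fT // vC // mulr0 addr0 subrr.
Qed.

End Completion.

Theorem theorem2 (R : realType) (d k : nat) (L0 : invariant_density R d)
    (L0_order : homogeneous_invariant false k L0)
    (L0_irreducible : irreducible L0)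
    (L0_completable : completable L0)
    (L0_sss : nonvanishing_on_sss L0)
    (L : invariant_density R d)
    (L_order : homogeneous_invariant false k L)
    (L_irreducible : irreducible L) :
  completable L.
Proof. exact: homogeneous_completable L_order. Qed.
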